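(* Let $m\ge1$ be an integer and $\delta>-m$. Let $w_m$ denote the unique root of $-w+(1-w)^m$ in $(0,1)$, and let $I(t)$ be the independent set produced after $t$ steps by the greedy independent set algorithm run on the preferential attachment process $\{G_{m,\delta}(t)\}$. For any $\chi\in\left(0,\min\left\{\frac13,\frac{2m+2\delta}{3(2m+\delta)}\right\}\right)$, almost surely $$\lim_{t\to\infty}t^{\chi}\left|\frac{|I(t)|}{t}-w_m\right|=0.$$
   Context: Preferential attachment process $\{G_{m,\delta}(t)\}_{t\ge1}$ (integer $m\ge1$, real $\delta\ge -m$): $G_{m,\delta}(1)$ is vertex $1$ with $m$ loops (a loop contributes $2$ to the degree). For $t\ge 1$, $G_{m,\delta}(t+1)$ is obtained by adding vertex $t+1$ and $m$ edges from it, one at a time: for $i=1,\dots,m$, with $d_{t,i-1}(x)$ the degree of $x$ just before the $i$-th edge of $t+1$ is added (so $d_{t,0}(t+1)=0$), the other endpoint $w$ of the $i$-th edge satisfies $\mathbb P(w=x)=\frac{d_{t,i-1}(x)+\delta}{(2m+\delta)t+2i-1+i\delta/m}$ for $x\in[t]$ and $\mathbb P(w=t+1)=\frac{d_{t,i-1}(t+1)+1+i\delta/m}{(2m+\delta)t+2i-1+i\delta/m}$ (a loop). Greedy independent set algorithm: $I(1)=\{1\}$; $I(t+1)=I(t)\cup\{t+1\}$ if none of the edges of vertex $t+1$ goes to a vertex of $I(t)$, and $I(t+1)=I(t)$ otherwise. *)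

(* Defs.v *)
From HB Require Import structures.
From mathcomp Require Export all_boot all_order all_algebra finmap.
From mathcomp Require Export all_classical all_reals all_analysis.

Set Implicit Arguments.
Unset Strict Implicit.
Unset Printing Implicit Defensive.

Export Order.TTheory GRing.Theory Num.Theory.
Export numFieldNormedType.Exports.

Local Open Scope classical_set_scope.
Local Open Scope ring_scope.

(* A multigraph on [t] = {1, ..., t} is represented by its edges in order of
   insertion; the edge (x, y) was inserted together with vertex x. *)
Definition degree (g : seq (nat * nat)) (x : nat) : nat :=
  (\sum_(e <- g) ((e.1 == x) + (e.2 == x)))%N.

(* In this file [w t i] is the other endpoint of the i-th edge of vertex t+1,
   for t >= 1 and 1 <= i <= m; its values at other indices are never used. *)

Definition new_edges (w : nat -> nat -> nat) (t k : nat) : seq (nat * nat) :=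
  [seq (t.+1, w t i) | i <- iota 1 k].

Fixpoint pa_graph (m : nat) (w : nat -> nat -> nat) (t : nat) :
    seq (nat * nat) :=
  match t with
  | 0%N => [::]
  | 1%N => nseq m (1%N, 1%N)
  | (_.+1 as t').+1 => pa_graph m w t' ++ new_edges w t' m
  end.

(* The graph just before the i-th edge of vertex t+1 is inserted: its degree
   function is d_{t,i-1}. As an ordered edge list it records the whole history
   of the process up to that moment. *)
Definition pa_graph_before (m : nat) (w : nat -> nat -> nat) (t i : nat) :
    seq (nat * nat) :=
  pa_graph m w t ++ new_edges w t i.-1.

Definition attach_prob (R : realType) (m : nat) (delta : R) (t i : nat)
    (g : seq (nat * nat)) (x : nat) : R :=
  let total := (2 * m%:R + delta) * t%:R + 2 * i%:R - 1 + i%:R * delta / m%:R in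
  if (1 <= x <= t)%N then ((degree g x)%:R + delta) / total
  else if x == t.+1 then
    ((degree g x)%:R + 1 + i%:R * delta / m%:R) / total
  else 0.

Definition cond_prob (d : measure_display) (Omega : measurableType d)
    (R : realType) (P : probability Omega R) (A B : set Omega) : R :=
  fine (P (A `&` B)) / fine (P B).

Definition preferential_attachment (d : measure_display)
    (Omega : measurableType d) (R : realType) (P : probability Omega R)
    (m : nat) (delta : R) (w : nat -> nat -> {RV P >-> nat}) : Prop :=
  forall (t i : nat), (1 <= t)%N -> (1 <= i <= m)%N ->
  forall (g : seq (nat * nat)) (x : nat),
    let history :=
      [set omega | pa_graph_before m (fun s j => w s j omega) t i = g] in
    (0 < P history)%E ->
    cond_prob P [set omega | w t i omega = x] history
      = attach_prob m delta t i g x.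

Fixpoint greedy_indep (m : nat) (w : nat -> nat -> nat) (t : nat) :
    {fset nat} :=
  match t with
  | 0%N => fset0
  | 1%N => [fset 1%N]%fset
  | (_.+1 as t').+1 =>
      let I := greedy_indep m w t' in
      if has (fun e => e.2 \in I) (new_edges w t' m) then I
      else (t'.+1 |` I)%fset
  end.

Lemma exists_unique_root (R : realType) (m : nat) : (1 <= m)%N ->
  exists! w : R, 0 < w < 1 /\ - w + (1 - w) ^+ m = 0.
Proof.
move=> m1; pose p : {poly R} := 'X - (1 - 'X) ^+ m.
have pE x : p.[x] = x - (1 - x) ^+ m by rewrite /p !hornerE.
have p0 : p.[0] = -1 by rewrite pE subr0 expr1n sub0r.
have p1 : p.[1] = 1 by rewrite pE subrr expr0n -[m == _]negbK -lt0n m1 subr0.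
have [|x /andP[x0 x1] /eqP px] := @poly_ivt R p 0 1 ler01.
  by rewrite p0 p1 lerN10 ler01.
have x0' : 0 < x.
  rewrite lt_neqAle x0 andbT; apply: contra_eq_neq px => <-.
  by rewrite p0 oppr_eq0 oner_eq0.
have x1' : x < 1.
  rewrite lt_neqAle x1 andbT; apply: contra_eq_neq px => ->.
  by rewrite p1 oner_eq0.
have rx : - x + (1 - x) ^+ m = 0.
  by apply/eqP; rewrite -oppr_eq0 opprD opprK -pE px.
exists x; split; first by rewrite x0' x1'.
have mono (a b : R) : 0 < a < 1 -> 0 < b < 1 -> a < b ->
    - b + (1 - b) ^+ m < - a + (1 - a) ^+ m.
  move=> /andP[a0 a1] /andP[b0 b1] ab; apply: ltr_leD; first by rewrite ltrN2.
  by apply: lerXn2r; rewrite ?nnegrE ?subr_ge0 ?ltW// ltrD2l ltrN2.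
move=> y [y01 ry]; have x01 : 0 < x < 1 by rewrite x0'.
case: (ltgtP x y) => // h.
- by have := mono _ _ x01 y01 h; rewrite rx ry ltxx.
- by have := mono _ _ y01 x01 h; rewrite rx ry ltxx.
Qed.

(* Main.v *)
Require Import Defs.
From mathcomp Require Import measurable_realfun ring lra.

(** Write [A t = |I(t)|], [S t] for the total degree of [I(t)] plus
    [delta * A t], [Q t] for the probability that the first edge of vertex
    [t + 1] hits [I(t)], [Y = Q - w_m] and [J = A t / t - w_m]. Up to errors of
    order [1 / t], each of the [m] edges of vertex [t + 1] hits [I(t)] with
    probability [Q t] independently of the others, so the vertex joins the set
    with probability about [(1 - Q)^m]. With [g = (m + delta) / (2 m + delta)]
    this gives
      [E Y'^2 <= (1 - 2 g / t) E Y^2 + O(1 / t^2)] and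
      [E J'^2 <= (1 - 1 / t) E J^2 + (m^2 / t) E Y^2 + O(1 / t^2)],
    because [(Q - w_m) (- Q + (1 - Q)^m) <= - (Q - w_m)^2]. A suitable combination
    [E J^2 + K E Y^2] is then [O(t^-a)] for every [a < min (1, 2 g)]; choosing
    [3 chi < a] makes [sum t^(3 chi - 1) J_t^2] integrable, hence almost surely
    finite, and since [|J_t - J_s| <= (t - s) / t] this forces
    [t^chi |J_t| -> 0]. *)

Set Implicit Arguments.
Unset Strict Implicit.
Unset Printing Implicit Defensive.

Local Open Scope classical_set_scope.
Local Open Scope ring_scope.

(** * Real sequences *)

(** With [x] factored out, [(1 + 1/x)^(-a) = exp (- a ln (1 + 1/x))]; then [ln (1 + y) <= y] and
    [exp z >= 1 + z] suffice. *)
Lemma powRN_bernoulli (R : realType) (a x : R) : 0 <= a -> 0 < x ->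
  x `^ (- a) * (1 - a / x) <= (x + 1) `^ (- a).
Proof.
move=> a0 x0; have -> : x + 1 = x * (1 + x^-1) by field; rewrite gt_eqF.
have xV : 0 < x^-1 by rewrite invr_gt0.
rewrite powRM; [|exact: ltW|by rewrite addr_ge0 ?ltW].
rewrite ler_wpM2l ?powR_ge0// /powR gt_eqF ?addr_gt0//.
apply: le_trans (expR_ge1Dx (- (a / x))) _.
rewrite ler_expR mulNr lerN2 ler_wpM2l// le_ln1Dx//.
by rewrite (lt_trans _ xV)// ltrN10.
Qed.

(** Discrete counterpart of integrating [x^(-1-e)], which makes the series below telescope. Same
    exponential comparison, with [x + 1] factored out. *)
Lemma powRN_telescope (R : realType) (e x : R) : 0 <= e -> 0 < x ->
  e * (x + 1) `^ (- (1 + e)) <= x `^ (- e) - (x + 1) `^ (- e).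
Proof.
move=> e0 x0; have x10 : 0 < x + 1 by rewrite addr_gt0.
have xx1 : -1 < - (x + 1)^-1 by rewrite ltrN2 invf_lt1// ltrDr.
have y0 : 0 < 1 - (x + 1)^-1 by rewrite subr_gt0 -ltrN2.
have xE : x = (x + 1) * (1 - (x + 1)^-1) by field; rewrite gt_eqF.
have -> : x `^ (- e) = (x + 1) `^ (- e) * (1 - (x + 1)^-1) `^ (- e).
  by rewrite {1}xE powRM// ltW.
have -> : (x + 1) `^ (- (1 + e)) = (x + 1) `^ (- e) * (x + 1)^-1.
  have -> : - (1 + e) = - e - 1 by lra.
  rewrite powRD; last by rewrite (gt_eqF x10) implybT.
  by rewrite powR_inv1// ltW.
rewrite mulrCA -[X in _ - X]mulr1 -mulrBr ler_wpM2l ?powR_ge0//.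
rewrite lerBrDl /powR gt_eqF//; apply: le_trans (expR_ge1Dx _) _.
by rewrite ler_expR mulNr -mulrN ler_wpM2l// lerNr le_ln1Dx.
Qed.

Lemma sum_powRN_le (R : realType) (e : R) (n : nat) : 0 < e ->
  \sum_(k < n) k.+1%:R `^ (- (1 + e)) <= 1 + e^-1.
Proof.
move=> e0; have eV : 0 < e^-1 by rewrite invr_gt0.
case: n => [|n]; first by rewrite big_ord0 addr_ge0// ltW.
(* The telescoped remainder is kept in the bound so that the induction closes; the leading 1 is the
   term [k = 0]. *)
suff : \sum_(k < n.+1) k.+1%:R `^ (- (1 + e))
       <= 1 + e^-1 * (1 - n.+1%:R `^ (- e)).
  have : 0 <= e^-1 * n.+1%:R `^ (- e) by rewrite mulr_ge0 ?powR_ge0// ltW.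
  lra.
elim: n => [|n IH]; first by rewrite big_ord_recr big_ord0/= !powR1 subrr mulr0 add0r addr0.
rewrite big_ord_recr/=; apply: le_trans (lerD IH (lexx _)) _.
have := powRN_telescope (ltW e0) (ltr0Sn R n); rewrite natr1 => h.
rewrite -addrA lerD2l -lerBrDl -mulrBr -(ler_pM2l e0) mulVKf ?gt_eqF//.
by apply: le_trans h _; lra.
Qed.

(** By induction: the surplus rate [(b - a) / t] applied to [B t^-a] absorbs [C / t^2], as
    [t^-1 <= t^-a]. What remains, [B t^-a (1 - a / t)], is at most [B (t + 1)^-a] by
    [powRN_bernoulli]. *)
Lemma recursion_powR_bound (R : realType) (v : nat -> R) (a b C : R) :
  0 <= a -> a < b -> b <= 1 -> 0 <= C ->
  (forall t, (1 <= t)%N -> v t.+1 <= (1 - b / t%:R) * v t + C / t%:R ^+ 2) ->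
  exists2 B, 0 <= B & forall t, (1 <= t)%N -> v t <= B * t%:R `^ (- a).
Proof.
(* [v 1] settles the base case, [C / (b - a)] the absorption of the error. *)
move=> a0 ab b1 C0 vS; pose B := Num.max (v 1%N) (C / (b - a)).
have BC : C <= B * (b - a).
  by rewrite -ler_pdivrMr ?subr_gt0// le_max lexx orbT.
have B0 : 0 <= B by rewrite le_max divr_ge0 ?orbT// subr_ge0 ltW.
exists B => //; elim=> // -[_ _|t /(_ isT) IH _].
  by rewrite powR1 mulr1 le_max lexx.
have x0 : 0 < t.+1%:R :> R by [].
apply: (le_trans (vS _ _)) => //.
have bx : 0 <= 1 - b / t.+1%:R.
  by rewrite subr_ge0 ler_pdivrMr// mul1r (le_trans b1)// ler1n.
apply: (le_trans (lerD (ler_wpM2l bx IH) (lexx _))).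
have := powRN_bernoulli a0 x0; rewrite natr1.
move=> /(ler_wpM2l B0); apply: le_trans.
set x := t.+1%:R in x0 bx *; set y := x `^ (- a).
have hy : x^-1 <= y.
  by rewrite -powR_inv1 ?(ltW x0)// ler_powR ?ler1n// lerN2 (le_trans (ltW ab)).
have : C / x ^+ 2 <= B * (b - a) * (x^-1 * y).
  rewrite expr2 invfM ler_pM// ?mulr_ge0 ?invr_ge0 ?(ltW x0)//.
  by rewrite ler_wpM2l// invr_ge0 ltW.
move: (C / x ^+ 2) (x^-1) y {hy} => p q y'; lra.
Qed.

(* If [s^chi |J s| >= e], the Lipschitz bound keeps [t^chi |J t|] of order [e]
   on a window of about [e s^(1 - chi)] times [t >= s]; with the exponent
   [3 chi - 1] such a window contributes at least [e^3 / 16] to the series. *)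
Lemma window_sum_cvg0 (R : realType) (J : nat -> R) (chi M : R) :
  0 < chi -> 3 * chi < 1 ->
  (forall s t, (1 <= s <= t)%N -> `|J t - J s| <= (t - s)%:R / t%:R) ->
  (forall n, \sum_(k < n) k.+1%:R `^ (3 * chi - 1) * J k.+1 ^+ 2 <= M) ->
  (fun t : nat => t%:R `^ chi * `|J t|) @ \oo --> (0 : R).
Proof.
move=> chi0 chi1 Jlip Jsum; pose b := 3 * chi - 1.
pose a k : R := k.+1%:R `^ b * J k.+1 ^+ 2.
have a0 k : 0 <= a k by rewrite mulr_ge0 ?powR_ge0 ?sqr_ge0.
pose u n := \sum_(k < n) a k.
have uS n k : u (n + k)%N = u n + \sum_(i < k) a (n + i)%N.
  by rewrite /u big_split_ord.
have u_mono : nondecreasing_seq u.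
  move=> i j ij; rewrite -(subnKC ij) uS lerDl.
  by apply: sumr_ge0.
have u_cvg : cvgn u.
  by apply: nondecreasing_is_cvgn => //; exists M => _ [n _ <-]; exact: Jsum.
have tail e : 0 < e -> exists N, forall n k, (N <= n)%N ->
    \sum_(i < k) a (n + i)%N < e.
  move=> e0; move/cvgrPdist_lt: (u_cvg) => /(_ e e0)[N _ hN].
  exists N => n k Nn; have := hN n Nn => /= h.
  have := nondecreasing_cvgn_le u_mono u_cvg (n + k)%N.
  rewrite uS; have := le_lt_trans (ler_norm _) h; lra.
(* Capping [e] at 1 keeps the window length [z] below at most [x]. *)
apply/cvgr0Pnorm_le => e0 e0_gt0; pose e := Num.min e0 1.
have e_gt0 : 0 < e by rewrite lt_min e0_gt0/=.
have e_le : e <= e0 by rewrite ge_min lexx.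
have e_le1 : e <= 1 by rewrite ge_min lexx orbT.
have [N hN] := tail (e ^+ 3 / 16) ltac:(by rewrite divr_gt0// exprn_gt0).
exists N.+1 => // -[//|s] /= Ns; rewrite ltnS in Ns.
rewrite normrM normr_id ger0_norm ?powR_ge0//.
apply: le_trans e_le; rewrite leNgt; apply/negP => hs.
set x := s.+1%:R in hs; have x0 : 0 < x by rewrite /x.
have x1 : 1 <= x by rewrite /x ler1n.
have xneq : x != 0 by rewrite gt_eqF.
pose y := x `^ chi; have y0 : 0 < y by rewrite powR_gt0.
pose z := e / 2 * (x / y).
have z0 : 0 <= z by rewrite !mulr_ge0 ?invr_ge0 ?ltW.
have y1 : 1 <= y by rewrite -(powRr0 x) ler_powR// ltW.
have zx : z <= x.
  rewrite /z -[leRHS]mul1r ler_pM ?divr_ge0 ?(ltW x0) ?(ltW y0) ?(ltW e_gt0)//.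
    lra.
  by rewrite ler_pdivrMr// ler_peMr// ltW.
pose n := Num.trunc z; have /andP[nz zn] := truncn_itv z0; rewrite -/n in nz zn.
have xb : x `^ b = y ^+ 3 / x.
  rewrite /b powRB ?xneq ?implybT// powRr1 ?ltW// [3 * chi]mulrC powRrM.
  by rewrite (powR_mulrn 3) ?powR_ge0.
have Jlow i : (i <= n)%N -> e / 2 / y <= `|J (s + i).+1|.
  move=> i_n; have := Jlip s.+1 (s + i).+1.
  rewrite !ltnS leq_addr => /(_ isT); rewrite subSS addKn => hJ.
  have hi : i%:R / (s + i).+1%:R <= e / 2 / y.
    have : i%:R / (s + i).+1%:R <= i%:R / x.
      rewrite ler_wpM2l// lef_pV2 ?posrE// /x ler_nat ltnS leq_addr.
      by [].
    move=> /le_trans; apply; rewrite ler_pdivrMr//.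
    have -> : e / 2 / y * x = z by rewrite /z; field; rewrite gt_eqF.
    by apply: le_trans nz; rewrite ler_nat.
  have hs' : e / y <= `|J s.+1| by rewrite ler_pdivrMr// mulrC ltW.
  have -> : e / 2 / y = e / y - e / 2 / y by lra.
  have : `|J s.+1| <= `|J (s + i).+1| + `|J (s + i).+1 - J s.+1|.
    by rewrite [X in _ + X]distrC -{1}(subrK (J (s + i).+1) (J s.+1)) addrC ler_normD.
  move: hs' (le_trans hJ hi); rewrite -[e / 2 / y]mulrA [2^-1 * _]mulrC mulrA.
  move: `|J s.+1| `|J (s + i).+1| `|_ - _| (e / y) => p q r1 r2; lra.
(* Times in the window are at most [2 x] and [-1 < b < 0], so the weight drops by at most a factor
   2. *)
have tlow i : (i <= n)%N -> x `^ b / 2 <= (s + i).+1%:R `^ b.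
  move=> i_n; set t : R := (s + i).+1%:R; have t0 : 0 < t by rewrite /t.
  have t2x : t <= 2 * x.
    rewrite /t -addSn natrD -/x mulr_natl mulr2n lerD2l.
    by rewrite (le_trans _ (le_trans nz zx))// ler_nat.
  have b0 : 0 <= - b by rewrite /b; lra.
  rewrite -[b]opprK !(powRN _ (- b)) -invfM lef_pV2 ?posrE ?mulr_gt0 ?powR_gt0//.
  apply: (@le_trans _ _ ((2 * x) `^ (- b))).
    by rewrite ge0_ler_powR// nnegrE ltW// mulr_gt0.
  rewrite powRM ?(ltW x0)// mulrC ler_wpM2l ?powR_ge0//.
  by rewrite -[leRHS]powRr1// ler_powR ?ler1n//; rewrite /b; lra.
have := hN s n.+1 Ns; apply/negP; rewrite -leNgt.
(* Window length times least weight times least square of [J]: as [x^b = y^3 / x], all powers of [x]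
   and [y] cancel. *)
have -> : e ^+ 3 / 16 = z * (x `^ b / 2 * (e / 2 / y) ^+ 2).
  rewrite xb /z; move: (gt_eqF y0) xneq; move: (x) (y) => X Y Y0 X0.
  by field; rewrite X0 Y0.
apply: (@le_trans _ _ (\sum_(i < n.+1) x `^ b / 2 * (e / 2 / y) ^+ 2)).
  rewrite sumr_const card_ord -[leRHS]mulr_natl ler_wpM2r ?(ltW zn)//.
  by rewrite mulr_ge0 ?sqr_ge0// divr_ge0 ?powR_ge0.
apply: ler_sum => -[i /=]; rewrite ltnS => i_n _.
rewrite ler_pM ?sqr_ge0 ?tlow// ?divr_ge0 ?powR_ge0//.
rewrite -[leRHS]real_normK ?num_real// lerXn2r ?nnegrE ?Jlow//.
by rewrite !divr_ge0 ?(ltW y0) ?(ltW e_gt0).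
Qed.

(** * The greedy set read off an edge list *)

(** Defined from the edge list alone, so that the set is a function of the history on which the
    attachment rule conditions. The step for a vertex reads only the edges with that source, so [h]
    may extend beyond time [t]. *)
Fixpoint edge_greedy (h : seq (nat * nat)) (t : nat) : {fset nat} :=
  match t with
  | 0%N => fset0
  | 1%N => [fset 1%N]%fset
  | (_.+1 as t').+1 =>
      let I := edge_greedy h t' in
      if has (fun e => (e.1 == t'.+1) && (e.2 \in I)) h then I
      else (t'.+1 |` I)%fset
  end.

Definition hits (t : nat) (h : seq (nat * nat)) : nat :=
  count (fun e => (e.1 == t.+1) && (e.2 \in edge_greedy h t)) h.

Definition loops (t : nat) (h : seq (nat * nat)) : nat :=
  count_mem (t.+1, t.+1) h.

Definition deg_in (A : {fset nat}) (h : seq (nat * nat)) : nat :=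
  (\sum_(e <- h) ((e.1 \in A) + (e.2 \in A)))%N.

(** The filter drops the edges of vertex [t + 1], so this quantity stays frozen while that vertex is
    being attached. *)
Definition indep_deg (t : nat) (h : seq (nat * nat)) : nat :=
  deg_in (edge_greedy h t) [seq e <- h | (e.1 <= t)%N].

(* [h] can be the edge list once [k] edges of vertex [t + 1] are inserted. *)
Definition pa_history (m t k : nat) (h : seq (nat * nat)) : Prop :=
  [/\ all (fun e => (0 < e.2 <= e.1)%N && (e.1 <= t.+1)%N) h,
      size h = (m * t + k)%N & count (fun e => e.1 == t.+1) h = k].

Lemma edge_greedySS h t : edge_greedy h t.+2 =
  if hits t.+1 h == 0%N then (t.+2 |` edge_greedy h t.+1)%fset
  else edge_greedy h t.+1.
Proof.
rewrite {1}/edge_greedy -/edge_greedy has_count.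
by rewrite -/(hits t.+1 h) lt0n; case: eqP.
Qed.

Lemma edge_greedy_cat h h' t : all (fun e => t < e.1)%N h' ->
  edge_greedy (h ++ h') t = edge_greedy h t.
Proof.
elim: t => // -[//|t] IH th; rewrite !edge_greedySS /hits.
rewrite IH; last by apply: sub_all th => e; apply: ltn_trans.
rewrite count_cat [X in (_ + X)%N](_ : _ = 0%N) ?addn0//.
apply/eqP; rewrite -leqn0 leqNgt -has_count; apply/hasPn => e /(allP th).
by move=> te; rewrite gtn_eqF.
Qed.

Lemma edge_greedy_mem h t x : x \in edge_greedy h t -> (0 < x <= t)%N.
Proof.
elim: t => // -[|t] IH; first by rewrite inE => /eqP ->.
have IH' : x \in edge_greedy h t.+1 -> (0 < x <= t.+2)%N.
  by move=> /IH /andP[-> /leq_trans]; apply.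
rewrite edge_greedySS; case: eqP => _; last exact: IH'.
by rewrite in_fset1U => /orP[/eqP ->|/IH'//]; rewrite leqnn.
Qed.

Lemma edge_greedy_card h t : (1 <= t)%N ->
  #|` edge_greedy h t.+1| = (#|` edge_greedy h t| + (hits t h == 0))%N.
Proof.
case: t => // t _; rewrite edge_greedySS; case: eqP => _; last by rewrite addn0.
rewrite cardfsU1 addnC; case: (boolP (_ \in _)) => // /edge_greedy_mem.
by rewrite ltnn andbF.
Qed.

Lemma edge_greedy_card_le h t : (#|` edge_greedy h t| <= t)%N.
Proof.
elim: t => [|[|t] IH]; rewrite ?cardfs0 ?cardfs1//.
by rewrite edge_greedy_card// -[leqRHS]addn1 leq_add// leq_b1.
Qed.

Lemma pa_graph_src m w t e : e \in pa_graph m w t -> (e.1 <= t)%N.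
Proof.
elim: t => // -[_|t IH]; first by move=> /= /nseqP[->].
rewrite /= mem_cat => /orP[/IH|/mapP[i _ ->]//]; exact: leqW.
Qed.

(** Link to the algorithm of the statement: edges appended later have larger sources and leave the
    earlier set alone, and older edges do not have the new vertex as source. *)
Lemma edge_greedy_pa_graph m w t :
  edge_greedy (pa_graph m w t) t = greedy_indep m w t.
Proof.
elim: t => // -[//|t] IH; rewrite edge_greedySS.
have -> : pa_graph m w t.+2 = pa_graph m w t.+1 ++ new_edges w t.+1 m by [].
have IE : edge_greedy (pa_graph m w t.+1 ++ new_edges w t.+1 m) t.+1
          = greedy_indep m w t.+1.
  rewrite edge_greedy_cat ?IH//; apply/allP => _ /mapP[i _ ->].
  exact: ltnSn.
rewrite /hits IE count_cat [X in (X + _)%N](_ : _ = 0%N).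
  rewrite add0n [RHS]/= -[in RHS]/(greedy_indep m w t.+1) has_count lt0n.
  have -> : count (fun e => (e.1 == t.+2) && (e.2 \in greedy_indep m w t.+1))
                  (new_edges w t.+1 m)
          = count (fun e => e.2 \in greedy_indep m w t.+1) (new_edges w t.+1 m).
    by apply: eq_in_count => _ /mapP[i _ ->]; rewrite eqxx.
  by case: eqP.
apply/eqP; rewrite -leqn0 leqNgt -has_count; apply/hasPn => e /pa_graph_src.
by rewrite -ltnS => h; rewrite ltn_eqF.
Qed.

Lemma edge_greedy_rcons h t x :
  edge_greedy (rcons h (t.+1, x)) t = edge_greedy h t.
Proof. by rewrite -cats1 edge_greedy_cat//= ltnSn. Qed.

Lemma indep_deg_rcons h t x :
  indep_deg t (rcons h (t.+1, x)) = indep_deg t h.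
Proof. by rewrite /indep_deg edge_greedy_rcons filter_rcons/= ltnn. Qed.

Lemma hits_rcons h t x :
  hits t (rcons h (t.+1, x)) = (hits t h + (x \in edge_greedy h t))%N.
Proof.
rewrite /hits edge_greedy_rcons -cats1 count_cat/=.
by rewrite eqxx addn0.
Qed.

Lemma loops_rcons h t x :
  loops t (rcons h (t.+1, x)) = (loops t h + (x == t.+1))%N.
Proof.
by rewrite /loops -cats1 count_cat/= addn0 xpair_eqE eqxx.
Qed.

Lemma hits_le h t : (hits t h <= count (fun e => e.1 == t.+1) h)%N.
Proof. by apply: sub_count => e /= /andP[]. Qed.

Lemma loops_le h t : (loops t h <= count (fun e => e.1 == t.+1) h)%N.
Proof. by apply: sub_count => e /= /eqP ->. Qed.

Lemma hits_eq0 m t h : pa_history m t 0 h -> hits t h = 0%N.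
Proof. by case=> _ _ h0; apply/eqP; rewrite -leqn0 -[leqRHS]h0 hits_le. Qed.

Lemma loops_eq0 m t h : pa_history m t 0 h -> loops t h = 0%N.
Proof. by case=> _ _ h0; apply/eqP; rewrite -leqn0 -[leqRHS]h0 loops_le. Qed.

Lemma pa_history_rcons m t k h x : pa_history m t k h ->
  (0 < x <= t.+1)%N -> pa_history m t k.+1 (rcons h (t.+1, x)).
Proof.
move=> [hall hs hc] xt; split; first by rewrite all_rcons/= leqnn xt hall.
  by rewrite size_rcons hs addnS.
by rewrite -cats1 count_cat hc/= eqxx addn1.
Qed.

Lemma pa_historyS m t h : pa_history m t m h -> pa_history m t.+1 0 h.
Proof.
move=> [hall hs hc]; split.
- by apply: sub_all hall => e /andP[-> /leqW].
- by rewrite hs addn0 mulnS addnC.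
- apply/eqP; rewrite -leqn0 leqNgt -has_count; apply/hasPn => e /(allP hall).
  by move=> /andP[_ h1]; rewrite ltn_eqF.
Qed.

Lemma count_sum (T : Type) (a : pred T) (s : seq T) :
  count a s = (\sum_(x <- s) a x)%N.
Proof. by rewrite -sum1_count big_mkcond; apply: eq_bigr => x _; case: (a x). Qed.

(** An edge of vertex [t + 1] has its source outside the set, so it contributes only if its target
    is hit. *)
Lemma deg_in_history m t k h : pa_history m t k h ->
  deg_in (edge_greedy h t) h = (indep_deg t h + hits t h)%N.
Proof.
move=> [hall _ _]; rewrite /indep_deg /deg_in /hits count_sum big_filter.
rewrite [X in (X + _)%N]big_mkcond -big_split; apply: eq_big_seq => e /(allP hall).
move=> /andP[_ et]; case: ltnP => te /=.
  have -> : e.1 = t.+1 by apply/eqP; rewrite eqn_leq et te.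
  rewrite eqxx [X in (X + _)%N](_ : _ = 0%N)//.
  case: (boolP (_ \in _)) => // /edge_greedy_mem; by rewrite ltnn andbF.
by rewrite ltn_eqF ?addn0.
Qed.

(** Every hit raises the degree of the old set by one. Without hits the new vertex joins with its
    own degree: its [k] edges, plus one more for each loop. *)
Lemma indep_degS m t k h : (1 <= t)%N -> pa_history m t k h ->
  indep_deg t.+1 h =
  (indep_deg t h + hits t h + (hits t h == 0) * (k + loops t h))%N.
Proof.
case: t => // t _ hist; have [hall _ hc] := hist.
rewrite {1}/indep_deg (_ : [seq e <- h | _] = h); last first.
  by apply/all_filterP; apply: sub_all hall => e /andP[].
rewrite edge_greedySS -(deg_in_history hist).
case: eqP => _; last by rewrite mul0n addn0.
rewrite mul1n -hc /loops !count_sum /deg_in -!big_split; apply: eq_big_seq => e.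
move=> /(allP hall)/andP[/andP[_ e21] e1]; rewrite !in_fset1U /=.
have tI : t.+2 \notin edge_greedy h t.+1.
  by apply/negP => /edge_greedy_mem; rewrite ltnn andbF.
have -> : (e == (t.+2, t.+2)) = (e.2 == t.+2).
  case: e e21 e1 => a b /= ba a2; rewrite xpair_eqE andbC; case: eqP => // bE.
  by rewrite eqn_leq a2 -bE ba.
case: (e.1 =P t.+2) => [->|_]; case: (e.2 =P t.+2) => [->|_];
  rewrite ?(negbTE tI) /=; case: (e.1 \in edge_greedy h t.+1);
  by case: (e.2 \in edge_greedy h t.+1).
Qed.

Lemma big_edge_greedy (R : Type) (idx : R) (op : Monoid.com_law idx) h t
    (F : nat -> R) :
  \big[op/idx]_(x <- iota 1 t.+1 | x \in edge_greedy h t) F x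
  = \big[op/idx]_(x <- edge_greedy h t) F x.
Proof.
rewrite -big_filter; apply: perm_big; apply: uniq_perm => //.
- exact/filter_uniq/iota_uniq.
- exact: fset_uniq.
- move=> x; rewrite mem_filter mem_iota /=.
  case: (boolP (x \in edge_greedy h t)) => //= /edge_greedy_mem /andP[-> /leqW].
  by rewrite add1n ltnS.
Qed.

Lemma sum_degree (s : seq nat) h : uniq s ->
  (\sum_(x <- s) degree h x)%N = (\sum_(e <- h) ((e.1 \in s) + (e.2 \in s)))%N.
Proof.
move=> us; rewrite exchange_big; apply: eq_bigr => e _.
rewrite big_split -!(count_uniq_mem _ us) !count_sum.
by congr addn; apply: eq_bigr => x _ /=; rewrite eq_sym.
Qed.

(** An edge with target [t + 1] also has source [t + 1], so only [k] edges count, each at most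
    twice. *)
Lemma degree_le_history m t k h : pa_history m t k h ->
  (degree h t.+1 <= 2 * k)%N.
Proof.
move=> [hall _ hc]; rewrite mul2n -addnn -{1}hc -{1}hc !count_sum -big_split.
rewrite /degree big_seq [leqRHS]big_seq; apply: leq_sum => e /(allP hall).
move=> /andP[/andP[_ e21] e1]; rewrite leq_add2l.
case: eqP => // e2; rewrite eqn_leq e1 -e2 e21; by [].
Qed.

(** * The attachment kernel *)

Section attachment_kernel.
Context (R : realType) (m : nat) (delta : R).
Hypotheses (hm : (1 <= m)%N) (hdelta : - m%:R < delta).

Let m_gt0 : 0 < m%:R :> R. Proof. by rewrite ltr0n. Qed.

Let c : R := 2 * m%:R + delta.

Definition pa_total (t i : nat) : R :=
  (2 * m%:R + delta) * t%:R + 2 * i%:R - 1 + i%:R * delta / m%:R.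

Lemma pa_rate_gt0 : 0 < 2 * m%:R + delta.
Proof. by move: m_gt0 hdelta; lra. Qed.

Lemma pa_totalE t k : pa_total t k.+1 = pa_total t 1 + k%:R * (c / m%:R).
Proof.
rewrite /pa_total /c -natr1; field; exact: lt0r_neq0.
Qed.

Lemma pa_total1 t : pa_total t 1 = c * t%:R + (1 + delta / m%:R).
Proof. rewrite /pa_total /c; field; exact: lt0r_neq0. Qed.

(** The constant term [1 + delta / m] is nonnegative because [delta > - m]. *)
Lemma pa_total1_ge t : c * t%:R <= pa_total t 1.
Proof.
rewrite pa_total1 lerDl -(pmulr_rge0 _ m_gt0) mulrDr mulr1 mulrCA divff ?gt_eqF//.
by move: m_gt0 hdelta; lra.
Qed.

Lemma pa_total_ge t k : pa_total t 1 <= pa_total t k.+1.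
Proof.
by rewrite [leRHS]pa_totalE lerDl mulr_ge0// divr_ge0// ltW// pa_rate_gt0.
Qed.

Lemma pa_total_gt0 t k : (1 <= t)%N -> 0 < pa_total t k.+1.
Proof.
move=> t1; apply: lt_le_trans (le_trans (pa_total1_ge t) (pa_total_ge t k)).
by rewrite mulr_gt0 ?pa_rate_gt0// ltr0n.
Qed.

Lemma sum_attach_prob t k h : (1 <= t)%N -> pa_history m t k h ->
  \sum_(x <- iota 1 t.+1) attach_prob m delta t k.+1 h x = 1.
Proof.
move=> t1 hist; have [hall hs _] := hist.
have T0 := pa_total_gt0 k t1.
have -> : \sum_(x <- iota 1 t.+1) attach_prob m delta t k.+1 h x =
  (\sum_(x <- iota 1 t.+1) (degree h x)%:R
    + (t%:R * delta + 1 + k.+1%:R * delta / m%:R)) / pa_total t k.+1.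
  have -> : iota 1 t.+1 = iota 1 t ++ [:: t.+1] by rewrite -[X in iota 1 X = _]addn1 iotaD.
  rewrite !big_cat/= !big_seq1.
  have -> : attach_prob m delta t k.+1 h t.+1 =
      ((degree h t.+1)%:R + 1 + k.+1%:R * delta / m%:R) / pa_total t k.+1.
    by rewrite /attach_prob ltnn andbF eqxx.
  have -> : \sum_(x <- iota 1 t) attach_prob m delta t k.+1 h x =
     (\sum_(x <- iota 1 t) (degree h x)%:R + t%:R * delta) / pa_total t k.+1.
    have -> : t%:R * delta = \sum_(x <- iota 1 t) delta.
      by rewrite big_const_seq count_predT size_iota iter_addr_0 mulr_natl.
    rewrite -big_split big_distrl/=; apply: eq_big_seq => x.
    by rewrite mem_iota add1n ltnS /attach_prob => ->.
  by rewrite -mulrDl; congr (_ / _); ring.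
rewrite -natr_sum sum_degree ?iota_uniq//.
(* All [m t + k] edges have both endpoints in [[t + 1]], so the degrees there sum to twice their
   number. *)
rewrite [X in X%:R](_ : _ = (2 * (m * t + k))%N); last first.
  rewrite -hs -sum1_size big_distrr [LHS]big_seq [RHS]big_seq.
  apply: eq_bigr => e /(allP hall) /andP[/andP[e0 e21] e1].
  rewrite !mem_iota !add1n !ltnS e1 e0 (leq_trans e21 e1).
  by rewrite (leq_trans e0 e21).
rewrite -[X in _ = X](@divff _ (pa_total t k.+1)) ?gt_eqF//; congr (_ / _).
by rewrite /pa_total natrM natrD natrM -natr1; ring.
Qed.

(** The set lies in [[t]], so only the first case of [attach_prob] occurs and the degrees add up to
    [deg_in]. *)
Lemma sum_attach_indep t k h : pa_history m t k h ->
  \sum_(x <- iota 1 t.+1 | x \in edge_greedy h t) attach_prob m delta t k.+1 h x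
  = ((indep_deg t h)%:R + (hits t h)%:R + delta * #|` edge_greedy h t|%:R)
    / pa_total t k.+1.
Proof.
move=> hist; rewrite big_edge_greedy -natrD -(deg_in_history hist) /deg_in.
rewrite -sum_degree ?fset_uniq// natr_sum.
have -> : delta * #|` edge_greedy h t|%:R = \sum_(x <- edge_greedy h t) delta.
  by rewrite big_const_seq count_predT iter_addr_0 mulr_natr.
rewrite -big_split big_distrl/=; apply: eq_big_seq => x /edge_greedy_mem.
by rewrite /attach_prob => ->.
Qed.

(** The degree of the new vertex is at most [2 m] and [(k + 1) / m <= 1], while the denominator is
    at least [c t]. *)
Lemma attach_loop_le t k h : (1 <= t)%N -> (k < m)%N -> pa_history m t k h ->
  attach_prob m delta t k.+1 h t.+1
  <= (2 * m%:R + 1 + `|delta|) / (2 * m%:R + delta) / t%:R.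
Proof.
move=> t1 km hist; rewrite /attach_prob ltnn andbF eqxx -/(pa_total t k.+1).
have T0 := pa_total_gt0 k t1; have t0 : 0 < t%:R :> R by rewrite ltr0n.
rewrite ler_pdivrMr// -[leRHS]mulrA.
have ge1 : 1 <= t%:R^-1 * pa_total t k.+1 / c.
  rewrite ler_pdivlMr ?pa_rate_gt0// mul1r -ler_pdivrMl ?invr_gt0// invrK mulrC.
  exact: le_trans (pa_total1_ge t) (pa_total_ge t k).
have d0 : 0 <= 2 * m%:R + 1 + `|delta| by rewrite !addr_ge0.
have -> : (2 * m%:R + 1 + `|delta|) / c * (t%:R^-1 * pa_total t k.+1)
   = (2 * m%:R + 1 + `|delta|) * (t%:R^-1 * pa_total t k.+1 / c).
  by rewrite -mulrA; congr (_ * _); rewrite mulrC.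
apply: le_trans (_ : 2 * m%:R + 1 + `|delta| <= _); last by rewrite ler_peMr.
rewrite -!addrA lerD//.
  rewrite -natrM ler_nat (leq_trans (degree_le_history hist))// leq_mul2l/=.
  exact: ltnW.
rewrite lerD2l (le_trans (ler_norm _))// normf_div normrM !normr_nat.
by rewrite mulrAC ler_piMl// ler_pdivrMr// mul1r ler_nat.
Qed.

End attachment_kernel.

(** * Laws of the histories and second moments *)

Lemma new_edgesS w t k :
  new_edges w t k.+1 = rcons (new_edges w t k) (t.+1, w t k.+1).
Proof.
rewrite /new_edges -[X in iota 1 X]addn1 iotaD map_cat cats1.
by rewrite add1n.
Qed.

(** Countability makes such an event a countable union of rectangles. *)
Lemma measurable_pair_preimage (d : measure_display) (Omega : measurableType d)
    (T U : countType) (X : Omega -> T) (Y : Omega -> U) :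
  (forall S, measurable (X @^-1` S)) -> (forall S, measurable (Y @^-1` S)) ->
  forall S : set (T * U), measurable [set omega | S (X omega, Y omega)].
Proof.
move=> mX mY S.
have -> : [set omega | S (X omega, Y omega)] =
    \bigcup_x (X @^-1` [set x] `&` Y @^-1` [set y | S (x, y)]).
  apply/seteqP; split => [omega /= Sxy|omega [x _ [/= <-]]//].
  by exists (X omega).
apply: countable_bigcupT_measurable; first exact: countableP.
by move=> x; apply: measurableI.
Qed.

Definition pa_extend (t : nat) (L : seq (seq (nat * nat))) :=
  [seq rcons h (t.+1, x) | h <- L, x <- iota 1 t.+1].

(** A finite list of histories carrying the whole law up to a null event, so that expectations
    become finite sums. The variables [w] may take other values, but only with probability zero. *)
Fixpoint pa_support (m t : nat) : seq (seq (nat * nat)) :=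
  match t with
  | 0%N => [::]
  | 1%N => [:: nseq m (1%N, 1%N)]
  | (_.+1 as t').+1 => iter m (pa_extend t') (pa_support m t')
  end.

Definition pa_supp (m t k : nat) := iter k (pa_extend t) (pa_support m t).

Lemma pa_suppS m t : (1 <= t)%N -> pa_supp m t.+1 0 = pa_supp m t m.
Proof. by case: t. Qed.

(** Induction in the order of edge insertion: along the [m] edges of a vertex, then from [(t, m)] to
    [(t + 1, 0)]. *)
Lemma pa_supp_ind (Q : nat -> nat -> Prop) m : Q 1%N 0%N ->
  (forall t k, (1 <= t)%N -> (k < m)%N -> Q t k -> Q t k.+1) ->
  (forall t, (1 <= t)%N -> Q t m -> Q t.+1 0%N) ->
  forall t k, (1 <= t)%N -> (k <= m)%N -> Q t k.
Proof.
move=> Q1 Qk Qt; have Qk' t k : (1 <= t)%N -> Q t 0%N -> (k <= m)%N -> Q t k.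
  move=> t1 Q0; elim: k => // k IH km; apply: Qk => //; apply: IH; exact: ltnW.
elim=> // -[_|t IH] k _ km; first exact: Qk'.
by apply: (Qk') => //; apply: Qt => //; apply: IH.
Qed.

Lemma pa_supp_history m t k h : (1 <= t)%N -> (k <= m)%N ->
  h \in pa_supp m t k -> pa_history m t k h.
Proof.
move=> t1 km; move: t k t1 km h; apply: pa_supp_ind.
- move=> h; rewrite inE => /eqP ->; split.
  + by apply/allP => _ /nseqP[->].
  + by rewrite size_nseq muln1 addn0.
  + by rewrite count_nseq.
- move=> t k t1 km IH _ /allpairsP[hx [hh xt ->]].
  by apply: pa_history_rcons; [exact: IH|rewrite mem_iota add1n ltnS in xt].
- by move=> t t1 IH h; rewrite pa_suppS// => /IH; exact: pa_historyS.
Qed.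

Lemma pa_supp_uniq m t k : (1 <= t)%N -> (k <= m)%N -> uniq (pa_supp m t k).
Proof.
move: t k; apply: pa_supp_ind => // [t k t1 km IH|t t1]; last by rewrite pa_suppS.
apply: allpairs_uniq => //; first exact: iota_uniq.
by move=> [h x] [h' x'] _ _ /= /rcons_inj[-> ->].
Qed.

Section history_expectation.
Context (d : measure_display) (Omega : measurableType d) (R : realType)
  (P : probability Omega R) (m : nat) (delta : R)
  (w : nat -> nat -> {RV P >-> nat}).
Hypotheses (hm : (1 <= m)%N) (hdelta : - m%:R < delta)
  (hw : preferential_attachment m delta w).

(** This is [pa_graph_before] at index [k + 1]: the history seen by the edge of index [k + 1]. *)
Definition pa_hist (t k : nat) (omega : Omega) : seq (nat * nat) :=
  pa_graph m (fun s j => w s j omega) t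
    ++ new_edges (fun s j => w s j omega) t k.

Definition hist_prob (t k : nat) (h : seq (nat * nat)) : R :=
  fine (P [set omega | pa_hist t k omega = h]).

Definition hist_expect (t k : nat) (F : seq (nat * nat) -> R) : R :=
  \sum_(h <- pa_supp m t k) hist_prob t k h * F h.

Lemma pa_histS t k omega :
  pa_hist t k.+1 omega = rcons (pa_hist t k omega) (t.+1, w t k.+1 omega).
Proof. by rewrite /pa_hist new_edgesS rcons_cat. Qed.

Lemma pa_histSS t omega : (1 <= t)%N -> pa_hist t.+1 0 omega = pa_hist t m omega.
Proof. by case: t => // t _; rewrite /pa_hist cats0. Qed.

Lemma pa_hist0 t omega : pa_hist t 0 omega = pa_graph m (fun s j => w s j omega) t.
Proof. by rewrite /pa_hist cats0. Qed.

Lemma measurable_pa_hist t k (S : set (seq (nat * nat))) : (1 <= t)%N -> (k <= m)%N ->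
  measurable [set omega | S (pa_hist t k omega)].
Proof.
move=> t1 km; move: t k t1 km S; apply: pa_supp_ind.
- move=> S; have [Sx|Sx] := pselect (S (nseq m (1%N, 1%N))).
    rewrite (_ : mkset _ = setT)//; apply/seteqP; split => // omega _ /=.
    by rewrite pa_hist0.
  rewrite (_ : mkset _ = set0)//; apply/seteqP; split => // omega /=.
  by rewrite pa_hist0.
- move=> t k t1 km IH S.
  have mw (A : set nat) : measurable (w t k.+1 @^-1` A).
    exact: measurable_funPTI.
  have := measurable_pair_preimage IH mw [set hx | S (rcons hx.1 (t.+1, hx.2))].
  congr measurable; apply/seteqP; split => omega /=; by rewrite pa_histS.
- move=> t t1 IH S; have := IH S.
  congr measurable; apply/seteqP; split => omega /=; by rewrite pa_histSS.
Qed.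

Lemma hist_prob_ge0 t k h : 0 <= hist_prob t k h.
Proof. exact: fine_ge0. Qed.

Lemma hist_prob_rcons t k h x : (1 <= t)%N -> (k < m)%N ->
  hist_prob t k.+1 (rcons h (t.+1, x))
  = hist_prob t k h * attach_prob m delta t k.+1 h x.
Proof.
move=> t1 km.
pose A := [set omega | w t k.+1 omega = x].
pose B := [set omega | pa_hist t k omega = h].
have mA : measurable A by exact: (measurable_funPTI (w t k.+1) (Y := [set x])).
have mB : measurable B by exact: (measurable_pa_hist [set h] t1 (ltnW km)).
have eAB : [set omega | pa_hist t k.+1 omega = rcons h (t.+1, x)] = A `&` B.
  apply/seteqP; split => omega /=; rewrite pa_histS; first by move=> /rcons_inj[].
  by move=> [Aw Bw]; congr (rcons _ (_, _)).
(* The attachment hypothesis speaks only of histories of positive probability; for a null history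
   both sides vanish. *)
rewrite /hist_prob eAB -/B; have [B0|B0] := eqVneq (P B) 0%E.
  rewrite B0/= mul0r (_ : P (A `&` B) = 0%E)//; apply/eqP.
  by rewrite -measure_le0 -B0 le_measure ?inE//; exact: measurableI.
have PB0 : (0 < P B)%E by rewrite lt0e B0 measure_ge0.
have := hw t1 (i := k.+1) km (g := h) x PB0.
rewrite /cond_prob -/A -/B => <-; rewrite mulrCA divff ?mulr1//.
by rewrite gt_eqF// fine_gt0// PB0 ltey_eq fin_num_measure.
Qed.

(** Read off from the chain rule: for negative [delta] the formula itself can be negative on an
    arbitrary edge list. *)
Lemma attach_prob_ge0 t k h x : (1 <= t)%N -> (k < m)%N -> 0 < hist_prob t k h ->
  0 <= attach_prob m delta t k.+1 h x.
Proof.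
move=> t1 km p0; rewrite -(pmulr_rge0 _ p0) -hist_prob_rcons//.
exact: hist_prob_ge0.
Qed.

(** Tower property: the last edge is averaged out by the kernel. *)
Lemma hist_expectS t k F : (1 <= t)%N -> (k < m)%N ->
  hist_expect t k.+1 F = hist_expect t k (fun h =>
    \sum_(x <- iota 1 t.+1)
      attach_prob m delta t k.+1 h x * F (rcons h (t.+1, x))).
Proof.
move=> t1 km; rewrite /hist_expect [pa_supp m t k.+1]iterS big_allpairs_dep.
apply: eq_bigr => h _; rewrite big_distrr; apply: eq_bigr => x _ /=.
by rewrite hist_prob_rcons// mulrA.
Qed.

Lemma hist_expectSS t F : (1 <= t)%N -> hist_expect t.+1 0 F = hist_expect t m F.
Proof.
move=> t1; rewrite /hist_expect pa_suppS//; apply: eq_bigr => h _.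
congr (fine (P _) * _); apply/seteqP; split => omega /=; by rewrite pa_histSS.
Qed.

Lemma hist_expectD t k F G : hist_expect t k (fun h => F h + G h)
  = hist_expect t k F + hist_expect t k G.
Proof. by rewrite -big_split; apply: eq_bigr => h _; rewrite mulrDr. Qed.

Lemma hist_expectZ t k a F : hist_expect t k (fun h => a * F h)
  = a * hist_expect t k F.
Proof. by rewrite /hist_expect big_distrr; apply: eq_bigr => h _; rewrite mulrCA. Qed.

Lemma hist_expect_le t k F G : (1 <= t)%N -> (k <= m)%N ->
  (forall h, h \in pa_supp m t k -> 0 < hist_prob t k h -> F h <= G h) ->
  hist_expect t k F <= hist_expect t k G.
Proof.
move=> t1 km FG; rewrite /hist_expect big_seq [leRHS]big_seq; apply: ler_sum => h hs.
have := hist_prob_ge0 t k h; rewrite le_eqVlt => /predU1P[<-|p0].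
  by rewrite !mul0r.
by rewrite ler_pM2l// FG.
Qed.

Lemma hist_expect_eq t k F G : (1 <= t)%N -> (k <= m)%N ->
  (forall h, h \in pa_supp m t k -> 0 < hist_prob t k h -> F h = G h) ->
  hist_expect t k F = hist_expect t k G.
Proof.
by move=> t1 km FG; apply/eqP; rewrite eq_le !hist_expect_le// => h hh ph; rewrite FG.
Qed.

Lemma hist_expect1 t k : (1 <= t)%N -> (k <= m)%N ->
  hist_expect t k (fun=> 1) = 1.
Proof.
move: t k; apply: pa_supp_ind.
- rewrite /hist_expect big_seq1 mulr1 /hist_prob (_ : mkset _ = setT).
    by rewrite probability_setT.
  by apply/seteqP; split => // omega _ /=; rewrite pa_hist0.
- move=> t k t1 km IH; rewrite hist_expectS// -[RHS]IH; apply: hist_expect_eq => //.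
    exact: ltnW.
  move=> h hh _; rewrite -[RHS](sum_attach_prob hm hdelta t1 (pa_supp_history t1 (ltnW km) hh)).
  by apply: eq_bigr => x _; rewrite mulr1.
- by move=> t t1; rewrite hist_expectSS.
Qed.

Lemma hist_expect_norm_le t k F a : (1 <= t)%N -> (k <= m)%N ->
  (forall h, h \in pa_supp m t k -> 0 < hist_prob t k h -> `|F h| <= a) ->
  `|hist_expect t k F| <= a.
Proof.
move=> t1 km Fa; have aE : hist_expect t k (fun=> a * 1) = a.
  by rewrite hist_expectZ hist_expect1// mulr1.
rewrite ler_norml; apply/andP; split.
  rewrite lerNl -mulN1r -hist_expectZ -[leRHS]aE; apply: hist_expect_le => // h hh ph.
  by have := Fa h hh ph; rewrite ler_norml => /andP[]; lra.
rewrite -[leRHS]aE; apply: hist_expect_le => // h hh ph; rewrite mulr1.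
exact: le_trans (ler_norm _) (Fa _ hh ph).
Qed.

Lemma measurable_hist_fun t (F : seq (nat * nat) -> R) : (1 <= t)%N ->
  measurable_fun setT (fun omega => (F (pa_hist t 0 omega))%:E).
Proof.
move=> t1 _ Y _; rewrite setTI.
exact: (measurable_pa_hist [set h | Y (F h)%:E] t1 (leq0n m)).
Qed.

(** Returns from finite sums to the integral: the events attached to the listed histories are
    disjoint, and their union [D] has full measure. *)
Lemma integral_hist t (F : seq (nat * nat) -> R) : (1 <= t)%N ->
  (forall h, 0 <= F h) ->
  (\int[P]_omega (F (pa_hist t 0 omega))%:E = (hist_expect t 0 F)%:E)%E.
Proof.
move=> t1; pose B h := [set omega | pa_hist t 0 omega = h].
have mB h : measurable (B h) by exact: (measurable_pa_hist [set h] t1 (leq0n m)).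
pose D := \big[setU/set0]_(h <- pa_supp m t 0) B h.
have mD : measurable D by apply: bigsetU_measurable.
have intD G : (forall h, 0 <= G h) ->
    (\int[P]_(omega in D) (G (pa_hist t 0 omega))%:E = (hist_expect t 0 G)%:E)%E.
  move=> G0; rewrite ge0_integral_bigsetU//.
  - rewrite /hist_expect -sumEFin; apply: eq_bigr => h _.
    rewrite (eq_integral (cst (G h)%:E)); last by move=> omega; rewrite inE => <-.
    rewrite integral_cst// muleC EFinM; congr (_ * _)%E.
    by rewrite /hist_prob fineK//; exact: (fin_num_measure P _ (mB h)).
  - exact: pa_supp_uniq.
  - by move=> h h' _ _ [omega [<- <-]].
  - exact/measurable_funTS/measurable_hist_fun.
  - by move=> omega _; rewrite lee_fin.
(* The identity on [D] for the constant 1, combined with [hist_expect1]. *)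
have PD : P D = 1%E.
  have := intD (fun=> 1) (fun=> ler01); rewrite hist_expect1// => <-.
  by rewrite integral_cst// mul1e.
have PDC : P (~` D) = 0%E by rewrite probability_setC// PD subee.
move=> F0; rewrite -(setUv D) ge0_integral_setU//.
- rewrite intD// null_set_integral ?adde0//; first exact: measurableC.
  exact/measurable_funTS/measurable_hist_fun.
- exact: measurableC.
- exact/measurable_funTS/measurable_hist_fun.
- by move=> omega _; rewrite lee_fin.
- by apply/disj_setPS => omega [].
Qed.


Lemma hist_reach_rcons t k h : (1 <= t)%N -> (k < m)%N ->
  h \in pa_supp m t k.+1 -> 0 < hist_prob t k.+1 h ->
  exists h' x, [/\ h = rcons h' (t.+1, x), h' \in pa_supp m t k
                 & 0 < hist_prob t k h'].
Proof.
move=> t1 km /allpairsP[[h' x] [h's _ ->]] /=; rewrite hist_prob_rcons// => p0.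
exists h', x; split => //; rewrite lt_neqAle hist_prob_ge0 andbT eq_sym.
by apply: contraTneq p0 => ->; rewrite mul0r ltxx.
Qed.

(** * Hits, misses and loops among the [m] edges of one vertex *)

Local Notation c := (2 * m%:R + delta).
Local Notation E := hist_expect.
Local Notation tau := (pa_total m delta).

Definition indep_card (t : nat) (h : seq (nat * nat)) : R :=
  #|` edge_greedy h t|%:R.

(** This is [S t]; [indep_card] is [A t] and [indep_frac] is [Q t]. *)
Definition indep_weight t h : R := (indep_deg t h)%:R + delta * indep_card t h.

(* The probability that the first edge of vertex [t + 1] hits the set. *)
Definition indep_frac t h : R := indep_weight t h / tau t 1.

Definition miss t h : R := (hits t h == 0%N)%:R.

Definition hit_prob t k h : R :=
  \sum_(x <- iota 1 t.+1 | x \in edge_greedy h t) attach_prob m delta t k.+1 h x.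

Definition hit_err : R := (m%:R + c) / c.

Definition loop_err : R := (2 * m%:R + 1 + `|delta|) / c.

Let c_gt0 : 0 < c. Proof. exact: pa_rate_gt0. Qed.

Lemma indep_frac_rcons t h x :
  indep_frac t (rcons h (t.+1, x)) = indep_frac t h.
Proof.
by rewrite /indep_frac /indep_weight /indep_card edge_greedy_rcons indep_deg_rcons.
Qed.

Lemma hit_prob_itv t k h : (1 <= t)%N -> (k < m)%N -> h \in pa_supp m t k ->
  0 < hist_prob t k h -> 0 <= hit_prob t k h <= 1.
Proof.
move=> t1 km hs p0; rewrite /hit_prob; apply/andP; split.
  by apply: sumr_ge0 => x _; exact: attach_prob_ge0.
have hh := pa_supp_history t1 (ltnW km) hs.
rewrite -[leRHS](sum_attach_prob hm hdelta t1 hh) big_mkcond; apply: ler_sum.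
by move=> x _; case: ifP => // _; exact: attach_prob_ge0.
Qed.

(** Before the first edge of a vertex it equals [hit_prob], a probability on reachable histories;
    the later edges of the vertex leave it unchanged. *)
Lemma indep_frac_itv t k h : (1 <= t)%N -> (k <= m)%N -> h \in pa_supp m t k ->
  0 < hist_prob t k h -> 0 <= indep_frac t h <= 1.
Proof.
move=> t1; elim: k h => [|k IH] h km hs p0.
  have hh := pa_supp_history t1 (leq0n m) hs.
  have := hit_prob_itv t1 hm hs p0; rewrite /hit_prob sum_attach_indep//.
  by rewrite (hits_eq0 hh) addr0.
have [h' [x [-> hs' p0']]] := hist_reach_rcons t1 km hs p0.
by rewrite indep_frac_rcons; apply: IH => //; exact: ltnW.
Qed.

(** Earlier edges of the block change the numerator by at most [m] hits and the denominator by
    [k c / m <= c]; the denominator is at least [c t], whence [(m + c) / (c t)]. *)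
Lemma hit_prob_near t k h : (1 <= t)%N -> (k < m)%N -> h \in pa_supp m t k ->
  0 < hist_prob t k h -> `|hit_prob t k h - indep_frac t h| <= hit_err / t%:R.
Proof.
move=> t1 km hs p0; have hh := pa_supp_history t1 (ltnW km) hs.
have t0 : 0 < t%:R :> R by rewrite ltr0n.
have m0 : 0 < m%:R :> R by rewrite ltr0n.
have T1 : 0 < tau t 1 := pa_total_gt0 hm hdelta 0 t1.
have Tk : 0 < tau t k.+1 := pa_total_gt0 hm hdelta k t1.
have /andP[Q0 Q1] := indep_frac_itv t1 (ltnW km) hs p0.
have -> : hit_prob t k h - indep_frac t h =
    ((hits t h)%:R - k%:R * (c / m%:R) * indep_frac t h) / tau t k.+1.
  apply: (mulIf (lt0r_neq0 Tk)); rewrite mulrBl [RHS]mulfVK ?gt_eqF//.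
  rewrite /hit_prob sum_attach_indep// mulfVK ?gt_eqF// {1}pa_totalE// mulrDr.
  rewrite [X in _ - (X + _)](_ : _ = indep_weight t h); last first.
    by rewrite /indep_frac mulfVK// gt_eqF.
  by rewrite /indep_weight; ring.
have ctk : c * t%:R <= tau t k.+1.
  exact: le_trans (pa_total1_ge hm hdelta t) (pa_total_ge hm hdelta t k).
rewrite normrM normfV (ger0_norm (ltW Tk)).
rewrite ler_pdivrMr// /hit_err.
have -> : (m%:R + c) / c / t%:R * tau t k.+1
        = (m%:R + c) * (tau t k.+1 / (c * t%:R)).
  by field; rewrite !gt_eqF.
apply: le_trans (_ : m%:R + c <= _); last first.
  have mc0 : 0 <= m%:R + c by move: m0 c_gt0; lra.
  by apply: ler_peMr => //; rewrite ler_pdivlMr ?mulr_gt0// mul1r.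
apply: le_trans (ler_normB _ _) _; apply: lerD.
  rewrite normr_nat ler_nat; case: hh => _ _ hk.
  by apply: leq_trans (ltnW km); rewrite -hk; exact: hits_le.
have kc0 : 0 <= k%:R * (c / m%:R).
  by rewrite mulr_ge0// divr_ge0// ltW.
rewrite ger0_norm; last exact: mulr_ge0.
rewrite -[leRHS]mulr1 ler_pM//.
by rewrite mulrCA ler_piMr ?(ltW c_gt0)// ler_pdivrMr// mul1r ler_nat ltnW.
Qed.

(** Test functions for the block estimates: unaffected by the edges of vertex [t + 1] and bounded by
    1 wherever the probability is positive. *)
Definition block_invariant t (phi : seq (nat * nat) -> R) :=
  (forall h x, phi (rcons h (t.+1, x)) = phi h) /\
  (forall k h, (k <= m)%N -> h \in pa_supp m t k -> 0 < hist_prob t k h ->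
     `|phi h| <= 1).

Lemma block_invariantM t phi psi : block_invariant t phi ->
  block_invariant t psi -> block_invariant t (fun h => phi h * psi h).
Proof.
move=> [p1 p2] [q1 q2]; split=> [h x|k h km hs p0]; first by rewrite p1 q1.
by rewrite normrM mulr_ile1// ?(p2 k) ?(q2 k).
Qed.

Lemma block_invariant_miss t : (1 <= t)%N ->
  block_invariant t (fun h => 1 - indep_frac t h).
Proof.
move=> t1; split=> [h x|k h km hs p0]; first by rewrite indep_frac_rcons.
by have /andP[? ?] := indep_frac_itv t1 km hs p0; rewrite ger0_norm; lra.
Qed.

Lemma expect_invariant t k (psi : seq (nat * nat) -> R) : (1 <= t)%N -> (k <= m)%N ->
  (forall h x, psi (rcons h (t.+1, x)) = psi h) -> E t k psi = E t 0 psi.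
Proof.
move=> t1 km pinv; elim: k km => // k IH km; rewrite hist_expectS// -IH 1?ltnW//.
apply: hist_expect_eq => // [|h hs _]; first exact: ltnW.
have hh := pa_supp_history t1 (ltnW km) hs.
under eq_bigr do rewrite pinv; rewrite -mulr_suml.
by rewrite (sum_attach_prob hm hdelta t1 hh) mul1r.
Qed.

Lemma miss_rcons t h x :
  miss t (rcons h (t.+1, x)) = miss t h * (1 - (x \in edge_greedy h t)%:R).
Proof.
rewrite /miss hits_rcons addn_eq0 eqb0.
by case: (_ == _); case: (_ \in _); rewrite /= ?subrr ?subr0 ?mulr0 ?mul0r ?mulr1.
Qed.

Lemma sum_attach_mem t k h (a b : R) : (1 <= t)%N -> (k < m)%N ->
  h \in pa_supp m t k ->
  \sum_(x <- iota 1 t.+1)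
     attach_prob m delta t k.+1 h x * (a + b * (x \in edge_greedy h t)%:R)
  = a + b * hit_prob t k h.
Proof.
move=> t1 km hs; have hh := pa_supp_history t1 (ltnW km) hs.
under eq_bigr do rewrite mulrDr [X in _ + X]mulrCA.
rewrite big_split -mulr_suml -mulr_sumr (sum_attach_prob hm hdelta t1 hh) mul1r.
congr (_ + _ * _); rewrite /hit_prob [RHS]big_mkcond; apply: eq_bigr => x _.
by case: (_ \in _); rewrite ?mulr1 ?mulr0.
Qed.

(** Each edge contributes a factor [1 - indep_frac] at cost [hit_err / t]. The induction varies
    [phi]: removing the last edge replaces [phi] by [phi * (1 - indep_frac)], which is again block
    invariant. *)
Lemma expect_miss t k phi : (1 <= t)%N -> (k <= m)%N -> block_invariant t phi ->
  `|E t k (fun h => phi h * miss t h) - E t 0 (fun h => phi h * (1 - indep_frac t h) ^+ k)|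
  <= k%:R * (hit_err / t%:R).
Proof.
move=> t1; elim: k phi => [|k IH] phi km phiI.
  rewrite (_ : _ - _ = 0) ?normr0 ?mul0r//; apply/eqP; rewrite subr_eq0; apply/eqP.
  apply: hist_expect_eq => // h hs _; rewrite expr0 /miss.
  by rewrite (hits_eq0 (pa_supp_history t1 km hs)).
have km' := ltnW km.
have := IH (fun h => phi h * (1 - indep_frac t h)) km'
  (block_invariantM phiI (block_invariant_miss t1)).
set e0 := E t 0 _; set ek := E t k _ => hk.
rewrite (_ : E t 0 _ = e0); last first.
  by apply: hist_expect_eq => // h _ _; rewrite exprS mulrA.
have -> : E t k.+1 (fun h => phi h * miss t h) =
    ek + E t k (fun h => phi h * miss t h * (indep_frac t h - hit_prob t k h)).
  rewrite /ek -hist_expectD hist_expectS//; apply: hist_expect_eq => // h hs p0.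
  transitivity (\sum_(x <- iota 1 t.+1) attach_prob m delta t k.+1 h x *
    (phi h * miss t h + (- (phi h * miss t h)) * (x \in edge_greedy h t)%:R)).
    by apply: eq_bigr => x _; rewrite phiI.1 miss_rcons; ring.
  by rewrite sum_attach_mem//; ring.
rewrite addrAC -natr1 mulrDl mul1r.
apply: le_trans (ler_normD _ _) _; apply: lerD => //.
apply: hist_expect_norm_le => // h hs p0; rewrite normrM [X in _ * X]distrC.
apply: le_trans (hit_prob_near t1 km hs p0); rewrite ler_piMl// normrM.
rewrite mulr_ile1//; first exact: (phiI.2 k).
by rewrite /miss normr_nat; case: (_ == _).
Qed.

(** Additive analogue: each edge adds [phi * indep_frac] on average, again at cost [hit_err / t]. *)
Lemma expect_hits t k phi : (1 <= t)%N -> (k <= m)%N -> block_invariant t phi ->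
  `|E t k (fun h => phi h * (hits t h)%:R)
    - k%:R * E t 0 (fun h => phi h * indep_frac t h)|
  <= k%:R * (hit_err / t%:R).
Proof.
move=> t1 + phiI; elim: k => [|k IH] km.
  rewrite !mul0r subr0 (_ : E t 0 _ = 0) ?normr0//.
  rewrite -[RHS](mul0r (E t 0 (fun=> 0))) -hist_expectZ.
  apply: hist_expect_eq => // h hs _.
  by rewrite (hits_eq0 (pa_supp_history t1 km hs)) !mulr0.
have km' := ltnW km; have := IH km'.
set e0 := E t 0 _; set ek := E t k _ => hk.
have e0E : e0 = E t k (fun h => phi h * indep_frac t h).
  by rewrite expect_invariant// => h x; rewrite phiI.1 indep_frac_rcons.
have -> : E t k.+1 (fun h => phi h * (hits t h)%:R) =
    ek + (e0 + E t k (fun h => phi h * (hit_prob t k h - indep_frac t h))).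
  rewrite e0E /ek -!hist_expectD hist_expectS//; apply: hist_expect_eq => // h hs p0.
  transitivity (\sum_(x <- iota 1 t.+1) attach_prob m delta t k.+1 h x *
    (phi h * (hits t h)%:R + phi h * (x \in edge_greedy h t)%:R)).
    by apply: eq_bigr => x _; rewrite phiI.1 hits_rcons natrD; ring.
  by rewrite sum_attach_mem//; ring.
set er := E t k _.
have -> : ek + (e0 + er) - k.+1%:R * e0 = (ek - k%:R * e0) + er.
  by rewrite -natr1; ring.
rewrite -natr1 mulrDl mul1r.
apply: le_trans (ler_normD _ _) _; apply: lerD => //.
apply: hist_expect_norm_le => // h hs p0; rewrite normrM.
apply: le_trans (hit_prob_near t1 km hs p0); rewrite ler_piMl//.
exact: (phiI.2 k).
Qed.

Lemma expect_loops t k : (1 <= t)%N -> (k <= m)%N ->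
  E t k (fun h => (loops t h)%:R) <= k%:R * (loop_err / t%:R).
Proof.
move=> t1; elim: k => [|k IH] km.
  rewrite mul0r -[leRHS](mul0r (E t 0 (fun=> 0))) -hist_expectZ.
  apply: hist_expect_le => // h hs _; rewrite mul0r.
  by rewrite (loops_eq0 (pa_supp_history t1 km hs)).
have km' := ltnW km; rewrite -natr1 mulrDl mul1r.
have eE : E t k (fun=> (loop_err / t%:R) * 1) = loop_err / t%:R.
  by rewrite hist_expectZ hist_expect1// mulr1.
apply: le_trans (lerD (IH km') (lexx _)); rewrite -[X in _ + X]eE -hist_expectD.
rewrite hist_expectS//; apply: hist_expect_le => // h hs p0.
have hh := pa_supp_history t1 km' hs.
under eq_bigr do rewrite loops_rcons natrD mulrDr.
rewrite big_split -mulr_suml (sum_attach_prob hm hdelta t1 hh) mul1r lerD2l mulr1.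
apply: le_trans (attach_loop_le hm hdelta t1 km hh).
rewrite (bigD1_seq t.+1) ?iota_uniq ?mem_iota ?add1n//= eqxx mulr1 big1 ?addr0//.
by move=> x /negbTE ->; rewrite mulr0.
Qed.

(** * Drift around the root and second-moment recursions *)

Context (wm : R).
Hypotheses (wm01 : 0 < wm < 1) (wmE : - wm + (1 - wm) ^+ m = 0).

Let wm_pow : (1 - wm) ^+ m = wm.
Proof. by move: wmE; lra. Qed.

Definition frac_dev t h : R := indep_frac t h - wm.
Definition card_dev t h : R := indep_card t h / t%:R - wm.

(** Split [- q + (1 - q)^m] as [(wm - q) + ((1 - q)^m - wm)]. As [(1 - x)^m] is nonincreasing on
    [[0, 1]] and fixes [wm], the second summand never has the sign of [q - wm]. *)
Lemma drift_contracts (q : R) : 0 <= q <= 1 ->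
  (q - wm) * (- q + (1 - q) ^+ m) <= - (q - wm) ^+ 2.
Proof.
move=> /andP[q0 q1]; have /andP[w0 w1] := wm01.
have : (q - wm) * ((1 - q) ^+ m - wm) <= 0.
  rewrite -{2}wm_pow; case: (leP wm q) => h.
    rewrite mulr_ge0_le0 ?subr_ge0// subr_le0.
    by apply: lerXn2r; rewrite ?nnegrE; lra.
  rewrite mulr_le0_ge0 ?subr_le0 ?(ltW h)// subr_ge0.
  by apply: lerXn2r; rewrite ?nnegrE; lra.
by move: ((1 - q) ^+ m) => z; rewrite expr2; lra.
Qed.

(** The [m]-th power is [m]-Lipschitz on [[0, 1]], by induction on the exponent. *)
Lemma frac_pow_lip (q : R) : 0 <= q <= 1 ->
  `|(1 - q) ^+ m - wm| <= m%:R * `|q - wm|.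
Proof.
move=> /andP[q0 q1]; have /andP[w0 w1] := wm01; rewrite -{1}wm_pow.
have -> : `|q - wm| = `|(1 - q) - (1 - wm)| by rewrite distrC; congr `|_|; ring.
have := subr_ge0 q 1; rewrite q1; have : 1 - q <= 1 by lra.
have : 0 <= 1 - wm by lra. have : 1 - wm <= 1 by lra.
move: (1 - q) (1 - wm) => a b b1 b0 a1 a0; elim: m => [|n IH].
  by rewrite !expr0 subrr normr0 mul0r.
have -> : a ^+ n.+1 - b ^+ n.+1 = a * (a ^+ n - b ^+ n) + (a - b) * b ^+ n.
  by rewrite !exprS; ring.
rewrite -natr1 [leRHS]mulrDl mul1r; apply: le_trans (ler_normD _ _) _; apply: lerD.
  by rewrite normrM (ger0_norm a0) (le_trans _ IH)// ler_piMl.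
by rewrite normrM ler_piMr// ger0_norm ?exprn_ge0// exprn_ile1.
Qed.

Lemma miss_itv t h : 0 <= miss t h <= 1.
Proof. by rewrite /miss; case: (_ == _); rewrite lexx ler01. Qed.

Lemma indep_cardS t h : (1 <= t)%N ->
  indep_card t.+1 h = indep_card t h + miss t h.
Proof. by move=> t1; rewrite /indep_card edge_greedy_card// natrD. Qed.

Lemma indep_weightS t h : (1 <= t)%N -> h \in pa_supp m t m ->
  indep_weight t.+1 h = indep_weight t h + ((hits t h)%:R
    + miss t h * (m%:R + delta) + miss t h * (loops t h)%:R).
Proof.
move=> t1 hs; have hh := pa_supp_history t1 (leqnn m) hs.
rewrite /indep_weight indep_cardS// (indep_degS t1 hh) !natrD natrM natrD /miss.
by ring.
Qed.

(** The normaliser grows by exactly [c] per vertex, so the numerator of the increment is the gain in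
    weight minus [c * indep_frac]. *)
Lemma indep_fracS t h : (1 <= t)%N -> h \in pa_supp m t m ->
  indep_frac t.+1 h = indep_frac t h + ((hits t h)%:R
    + miss t h * (m%:R + delta) + miss t h * (loops t h)%:R
    - c * indep_frac t h) / tau t.+1 1.
Proof.
move=> t1 hs.
have T1 : 0 < tau t 1 := pa_total_gt0 hm hdelta 0 t1.
have T2 : 0 < tau t.+1 1 := pa_total_gt0 hm hdelta 0 (leqW t1).
have TS : tau t.+1 1 = tau t 1 + c by rewrite !pa_total1// -natr1; ring.
apply: (mulIf (lt0r_neq0 T2)); rewrite {1}/indep_frac mulfVK ?gt_eqF//.
rewrite mulrDl [X in _ = _ + X]mulfVK ?gt_eqF// indep_weightS// TS [indep_frac t h * _]mulrDr.
have -> : indep_frac t h * tau t 1 = indep_weight t h.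
  by rewrite /indep_frac mulfVK// gt_eqF.
by ring.
Qed.

Lemma block_invariant_frac_dev t : (1 <= t)%N -> block_invariant t (frac_dev t).
Proof.
move=> t1; split=> [h x|k h km hs p0]; first by rewrite /frac_dev indep_frac_rcons.
have /andP[? ?] := indep_frac_itv t1 km hs p0; have /andP[? ?] := wm01.
by rewrite /frac_dev ler_norml; apply/andP; split; lra.
Qed.

Lemma card_frac_itv t h : (1 <= t)%N -> 0 <= indep_card t h / t%:R <= 1.
Proof.
move=> t1; rewrite divr_ge0//= ler_pdivrMr ?ltr0n// mul1r ler_nat.
exact: edge_greedy_card_le.
Qed.

Lemma block_invariant_card_dev t : (1 <= t)%N -> block_invariant t (card_dev t).
Proof.
move=> t1; split=> [h x|k h km hs p0].
  by rewrite /card_dev /indep_card edge_greedy_rcons.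
have /andP[? ?] := card_frac_itv h t1; have /andP[? ?] := wm01.
by rewrite /card_dev ler_norml; apply/andP; split; lra.
Qed.

Let inv_sq_le1 t phi : (1 <= t)%N -> block_invariant t phi ->
  E t 0 (fun h => phi h ^+ 2) <= 1.
Proof.
move=> t1 phiI; rewrite -[leRHS](hist_expect1 t1 (leq0n m)).
apply: hist_expect_le => // h hs p0; rewrite -real_normK ?num_real//.
by rewrite exprn_ile1// (phiI.2 0%N).
Qed.

Let sq_ge0 t F : (1 <= t)%N -> 0 <= E t 0 (fun h => F h ^+ 2).
Proof.
move=> t1; rewrite -(mul0r (E t 0 (fun=> 1))) -hist_expectZ.
by apply: hist_expect_le => // h _ _; rewrite mul0r sqr_ge0.
Qed.

Let hit_err_ge0 : 0 <= hit_err.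
Proof.
have m0 : 0 < m%:R :> R by rewrite ltr0n.
by rewrite divr_ge0 ?(ltW c_gt0)//; move: m0 c_gt0; lra.
Qed.

(** The square of [Y' = Y + D v] is expanded, with [v = 1 / tau (t + 1) 1]. The cross term has the
    drift of [drift_contracts], and everything else is of order [1 / t^2]. *)
Lemma frac_moment_step : exists2 K, 0 <= K & forall t, (1 <= t)%N ->
  E t.+1 0 (fun h => frac_dev t.+1 h ^+ 2)
  <= (1 - 2 * ((m%:R + delta) / c) / t%:R) * E t 0 (fun h => frac_dev t h ^+ 2)
     + K / t%:R ^+ 2.
Proof.
have m0 : 0 < m%:R :> R by rewrite ltr0n.
have md0 : 0 < m%:R + delta by move: hdelta; lra.
have he0 := hit_err_ge0.
have le0 : 0 <= loop_err.
  rewrite divr_ge0 ?(ltW c_gt0)//; have := normr_ge0 delta; move: m0; lra.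
have r0 : 0 <= 1 + delta / m%:R.
  by rewrite -(pmulr_rge0 _ m0) mulrDr mulr1 mulrCA divff ?gt_eqF// mulr1 ltW.
(* [C3] bounds the numerator [|D|] of the increment, [C4] collects the hit, miss and loop errors,
   and [C5] pays for replacing [v] by [1 / (c t)]. *)
pose C3 : R := 3 * m%:R + delta + c.
pose C4 : R := (m%:R + delta + 1) * (m%:R * hit_err) + m%:R * loop_err.
pose C5 : R := 2 * (m%:R + delta) * (c + (1 + delta / m%:R)) / c ^+ 2.
have cr0 : 0 <= c + (1 + delta / m%:R) by rewrite addr_ge0// ltW.
have C4_ge0 : 0 <= C4.
  have a1 : 0 <= m%:R + delta + 1 by move: md0; lra.
  by apply: addr_ge0; [apply: (mulr_ge0 a1); apply: mulr_ge0|apply: mulr_ge0].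
have C5_ge0 : 0 <= C5.
  apply: divr_ge0; last exact: sqr_ge0.
  by apply: mulr_ge0 => //; apply: mulr_ge0 => //; exact: ltW.
pose K := 2 * C4 / c + C3 ^+ 2 / c ^+ 2 + C5.
exists K => [|t t1].
  apply: addr_ge0 => //; apply: addr_ge0; last by rewrite divr_ge0 ?sqr_ge0.
  by apply: divr_ge0; [apply: mulr_ge0|exact: ltW].
rewrite /K; have t0 : 0 < t%:R :> R by rewrite ltr0n.
have T2 : 0 < tau t.+1 1 := pa_total_gt0 hm hdelta 0 (leqW t1).
pose u := t%:R^-1 : R; pose v := (tau t.+1 1)^-1.
have u0 : 0 < u by rewrite invr_gt0.
have v0 : 0 < v by rewrite invr_gt0.
have vu : v <= u / c.
  rewrite /u /v -invfM lef_pV2 ?posrE ?mulr_gt0// mulrC.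
  apply: le_trans (pa_total1_ge hm hdelta t.+1).
  by rewrite ler_wpM2l ?(ltW c_gt0)// ler_nat.
have uv : u / c - v <= (c + (1 + delta / m%:R)) / c ^+ 2 * u ^+ 2.
  have -> : u / c - v = (c + (1 + delta / m%:R)) * (u / c) * v.
    rewrite /u /v; apply: (mulIf (lt0r_neq0 T2)); rewrite mulrBl mulVf ?gt_eqF//.
    rewrite [RHS]mulfVK ?gt_eqF// pa_total1// -natr1; field.
    by rewrite !gt_eqF.
  have -> : (c + (1 + delta / m%:R)) / c ^+ 2 * u ^+ 2
          = (c + (1 + delta / m%:R)) * (u / c) * (u / c).
    by field; rewrite !gt_eqF.
  by rewrite ler_wpM2l// mulr_ge0// divr_ge0// ltW.
have Yinv := block_invariant_frac_dev t1.
set y := E t 0 (fun h => frac_dev t h ^+ 2).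
have y0 : 0 <= y by exact: sq_ge0.
have y1 : y <= 1 by exact: inv_sq_le1.
pose Z := E t 0 (fun h => frac_dev t h * indep_frac t h).
pose W := E t 0 (fun h => frac_dev t h * (1 - indep_frac t h) ^+ m).
pose X1 := E t m (fun h => frac_dev t h * (hits t h)%:R).
pose X2 := E t m (fun h => frac_dev t h * miss t h).
pose X3 := E t m (fun h => frac_dev t h * (miss t h * (loops t h)%:R)).
have X1_le : X1 <= m%:R * Z + m%:R * (hit_err * u).
  by have := expect_hits t1 (leqnn m) Yinv; move=> /(le_trans (ler_norm _)); rewrite lerBlDl.
have X2_le : X2 <= W + m%:R * (hit_err * u).
  by have := expect_miss t1 (leqnn m) Yinv; move=> /(le_trans (ler_norm _)); rewrite lerBlDl.
have X3_le : X3 <= m%:R * (loop_err * u).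
  apply: le_trans (expect_loops t1 (leqnn m)); apply: hist_expect_le => // h hs p0.
  rewrite mulrA ler_piMl// (le_trans (ler_norm _))// normrM mulr_ile1//.
    exact: (Yinv.2 m).
  by have /andP[? ?] := miss_itv t h; rewrite ger0_norm.
have WZ : W - Z <= - y.
  rewrite -[Z]mul1r -[- y]mulN1r -mulNr /W /Z /y -!hist_expectZ -hist_expectD.
  apply: hist_expect_le => // h hs p0.
  have := drift_contracts (indep_frac_itv t1 (leq0n m) hs p0).
  by rewrite /frac_dev; move: (_ ^+ m) => z; lra.
have step : E t.+1 0 (fun h => frac_dev t.+1 h ^+ 2) <=
    y + 2 * v * (X1 + (m%:R + delta) * X2 + X3 - c * Z) + (C3 * v) ^+ 2.
  rewrite hist_expectSS//.
  have -> : y = E t m (fun h => frac_dev t h ^+ 2).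
    by rewrite expect_invariant// => h x; rewrite Yinv.1.
  have -> : Z = E t m (fun h => frac_dev t h * indep_frac t h).
    by rewrite expect_invariant// => h x; rewrite Yinv.1 indep_frac_rcons.
  have -> : (C3 * v) ^+ 2 = (C3 * v) ^+ 2 * E t m (fun=> 1).
    by rewrite hist_expect1// mulr1.
  rewrite -mulNr /X1 /X2 /X3 -!hist_expectZ -!hist_expectD -hist_expectZ -!hist_expectD.
  apply: hist_expect_le => // h hs p0.
  have hh := pa_supp_history t1 (leqnn m) hs.
  rewrite {1}/frac_dev indep_fracS// -/v.
  have /andP[q0 q1] := indep_frac_itv t1 (leqnn m) hs p0.
  have /andP[b0 b1] := miss_itv t h.
  have [_ _ hk] := hh.
  have h1 : (hits t h)%:R <= m%:R :> R.
    by rewrite ler_nat (leq_trans (hits_le h t))// hk.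
  have l1 : (loops t h)%:R <= m%:R :> R.
    by rewrite ler_nat (leq_trans (loops_le h t))// hk.
  have h0 : 0 <= (hits t h)%:R :> R by [].
  have l0 : 0 <= (loops t h)%:R :> R by [].
  rewrite /frac_dev; move: ((hits t h)%:R) ((loops t h)%:R) (miss t h) (indep_frac t h)
    h0 h1 l0 l1 b0 b1 q0 q1 => N L b q N0 N1 L0 L1 b0 b1 q0 q1.
  set D := N + b * (m%:R + delta) + b * L - c * q.
  have D1 : `|D| <= C3.
    have bm0 : 0 <= b * (m%:R + delta) by rewrite mulr_ge0// ltW.
    have bm1 : b * (m%:R + delta) <= m%:R + delta by rewrite ler_piMl// ltW.
    have bL0 : 0 <= b * L by rewrite mulr_ge0.
    have bL1 : b * L <= m%:R by rewrite (le_trans _ L1)// ler_piMl.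
    have cq0 : 0 <= c * q by rewrite mulr_ge0// ltW.
    have cq1 : c * q <= c by rewrite ler_piMr// ltW.
    rewrite ler_norml /D /C3; apply/andP; split; lra.
  have D2 : (D * v) ^+ 2 <= (C3 * v) ^+ 2 * 1.
    rewrite mulr1 !exprMn ler_wpM2r ?sqr_ge0// -[D ^+ 2]real_normK ?num_real//.
    by rewrite lerXn2r ?nnegrE// (le_trans (normr_ge0 _) D1).
  apply: le_trans (lerD (lexx _) D2); rewrite le_eqVlt; apply/orP; left; apply/eqP.
  by rewrite /D; ring.
apply: le_trans step _.
(* Since [c = m + (m + delta)], the main terms [m Z + (m + delta) W - c Z] reduce to
   [(m + delta) (W - Z)], which [WZ] bounds. *)
have s1 : 2 * v * (X1 + (m%:R + delta) * X2 + X3 - c * Z)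
   <= 2 * v * (- (m%:R + delta) * y + C4 * u).
  rewrite ler_wpM2l ?mulr_ge0 ?(ltW v0)//.
  have := ler_wpM2l (ltW md0) X2_le; have := ler_wpM2l (ltW md0) WZ.
  by rewrite /C4; move: X1_le X3_le; lra.
have s2 : 2 * v * (C4 * u) <= 2 * C4 / c * u ^+ 2.
  have -> : 2 * C4 / c * u ^+ 2 = 2 * (u / c) * (C4 * u) by rewrite expr2; ring.
  by rewrite ler_wpM2r ?mulr_ge0 ?(ltW u0)// ler_wpM2l.
have s3 : (C3 * v) ^+ 2 <= C3 ^+ 2 / c ^+ 2 * u ^+ 2.
  have -> : C3 ^+ 2 / c ^+ 2 * u ^+ 2 = C3 ^+ 2 * (u / c) ^+ 2.
    by rewrite expr_div_n [RHS]mulrA mulrAC.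
  rewrite exprMn ler_wpM2l ?sqr_ge0// lerXn2r ?nnegrE ?(ltW v0)//.
  by rewrite (le_trans (ltW v0)).
have s4 : 2 * (m%:R + delta) * (u / c - v) * y <= C5 * u ^+ 2.
  apply: le_trans (_ : 2 * (m%:R + delta) * ((c + (1 + delta / m%:R)) / c ^+ 2 * u ^+ 2) <= _).
    have a0 : 0 <= 2 * (m%:R + delta) * (u / c - v).
      by rewrite !mulr_ge0 ?subr_ge0 ?(ltW md0).
    apply: le_trans (_ : 2 * (m%:R + delta) * (u / c - v) <= _); first by rewrite ler_piMr.
    by rewrite ler_wpM2l// mulr_ge0// ltW.
  by rewrite /C5 le_eqVlt; apply/orP; left; apply/eqP; ring.
have -> : 2 * ((m%:R + delta) / c) / t%:R = 2 * (m%:R + delta) * (u / c).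
  by rewrite -!mulrA [c^-1 * _]mulrC.
rewrite -exprVn -/u; move: s1 s2 s3 s4.
rewrite !(mulrDl _ _ (u ^+ 2)).
move: (C3 ^+ 2 / c ^+ 2 * u ^+ 2) (2 * C4 / c * u ^+ 2) (C5 * u ^+ 2) ((C3 * v) ^+ 2).
move=> z1 z2 z3 z4; move: (u / c) => uc; lra.
Qed.

(** Here [J' = J + (miss - wm - J) / (t + 1)]. The cross term gives [- 2 J^2] and
    [2 J ((1 - Q)^m - wm)]; the latter is at most [J^2 + m^2 Y^2], so one copy of [- J^2]
    survives. *)
Lemma card_moment_step : exists2 K, 0 <= K & forall t, (1 <= t)%N ->
  E t.+1 0 (fun h => card_dev t.+1 h ^+ 2)
  <= (1 - 1 / t%:R) * E t 0 (fun h => card_dev t h ^+ 2)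
     + m%:R ^+ 2 / t%:R * E t 0 (fun h => frac_dev t h ^+ 2)
     + K / t%:R ^+ 2.
Proof.
have m0 : 0 < m%:R :> R by rewrite ltr0n.
have he0 := hit_err_ge0.
pose C4 : R := m%:R * hit_err.
have C40 : 0 <= C4 by rewrite mulr_ge0.
(* One unit each for the squared increment and for replacing [1 / (t + 1)] by [1 / t]; [2 C4] for
   the error of [expect_miss]. *)
exists (2 + 2 * C4) => [|t t1]; first by rewrite addr_ge0// mulr_ge0.
have t0 : 0 < t%:R :> R by rewrite ltr0n.
pose u := t%:R^-1 : R; pose v := t.+1%:R^-1 : R.
have u0 : 0 < u by rewrite invr_gt0.
have v0 : 0 < v by rewrite invr_gt0.
have vu : v <= u by rewrite lef_pV2 ?posrE// ler_nat.
have uv : u - v <= u ^+ 2.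
  have -> : u - v = u * v by rewrite /u /v -natr1; field; rewrite !gt_eqF ?addr_gt0.
  by rewrite expr2 ler_wpM2l// ltW.
have Jinv := block_invariant_card_dev t1.
set j := E t 0 (fun h => card_dev t h ^+ 2).
set y := E t 0 (fun h => frac_dev t h ^+ 2).
have j0 : 0 <= j by exact: sq_ge0.
have y0 : 0 <= y by exact: sq_ge0.
have j1 : j <= 1 by exact: inv_sq_le1.
pose W := E t 0 (fun h => card_dev t h * (1 - indep_frac t h) ^+ m).
pose Z := E t 0 (fun h => card_dev t h).
pose X := E t m (fun h => card_dev t h * miss t h).
have X_le : X <= W + C4 * u.
  have := expect_miss t1 (leqnn m) Jinv; move=> /(le_trans (ler_norm _)).
  by rewrite lerBlDl /C4 -mulrA.
have WZ : 2 * (W - wm * Z) <= j + m%:R ^+ 2 * y.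
  rewrite -mulNr /W /Z /j /y -!hist_expectZ -!hist_expectD -hist_expectZ.
  apply: hist_expect_le => // h hs p0.
  have := frac_pow_lip (indep_frac_itv t1 (leq0n m) hs p0).
  rewrite -/(frac_dev t h); move: (_ ^+ m) (card_dev t h) (frac_dev t h) => z a b.
  move=> hz; have zb : (z - wm) ^+ 2 <= m%:R ^+ 2 * b ^+ 2.
    rewrite -[(z - wm) ^+ 2]real_normK ?num_real// -[b ^+ 2]real_normK ?num_real//.
    by rewrite -exprMn lerXn2r ?nnegrE// mulr_ge0.
  have := sqr_ge0 (a - (z - wm)); move: zb; rewrite !expr2; lra.
have step : E t.+1 0 (fun h => card_dev t.+1 h ^+ 2) <=
    j + 2 * v * (X - wm * Z - j) + v ^+ 2.
  rewrite hist_expectSS//.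
  have -> : j = E t m (fun h => card_dev t h ^+ 2).
    by rewrite expect_invariant// => h x; rewrite Jinv.1.
  have -> : Z = E t m (fun h => card_dev t h).
    by rewrite expect_invariant// => h x; rewrite Jinv.1.
  have -> : v ^+ 2 = v ^+ 2 * E t m (fun=> 1) by rewrite hist_expect1// mulr1.
  rewrite -[X in _ - X]mul1r -!mulNr /X -!hist_expectZ -!hist_expectD -hist_expectZ -!hist_expectD.
  apply: hist_expect_le => // h hs p0.
  have /andP[b0 b1] := miss_itv t h.
  have /andP[a0 a1] := card_frac_itv h t1.
  have -> : card_dev t.+1 h = card_dev t h + (miss t h - wm - card_dev t h) * v.
    rewrite /card_dev indep_cardS// /v -natr1; field; rewrite !gt_eqF ?addr_gt0//.
  have : `|miss t h - wm - card_dev t h| <= 1.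
    by rewrite /card_dev ler_norml; apply/andP; split; lra.
  move: (miss t h) (card_dev t h) => b a.
  rewrite -(@expr_le1 _ 2)// real_normK ?num_real// => hb.
  have : ((b - wm - a) * v) ^+ 2 <= v ^+ 2.
    by rewrite exprMn ler_piMl ?sqr_ge0.
  by rewrite !expr2; lra.
apply: le_trans step _.
have s1 : 2 * v * (X - wm * Z - j) <= v * (m%:R ^+ 2 * y - j) + 2 * v * (C4 * u).
  have := ler_wpM2l (ltW v0) WZ; have := ler_wpM2l (ltW v0) X_le.
  by move: (m%:R ^+ 2 * y) => z; lra.
have s2 : v * (C4 * u) <= C4 * u ^+ 2.
  by rewrite expr2 [leRHS]mulrA mulrC ler_wpM2l// mulr_ge0// ltW.
have s3 : v ^+ 2 <= u ^+ 2 by rewrite lerXn2r ?nnegrE// ltW.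
have s4 : (u - v) * j <= u ^+ 2.
  by apply: le_trans uv; rewrite ler_piMr// subr_ge0.
have s5 : v * (m%:R ^+ 2 * y) <= u * (m%:R ^+ 2 * y).
  by rewrite ler_wpM2r// mulr_ge0// sqr_ge0.
have -> : m%:R ^+ 2 / t%:R * y = u * (m%:R ^+ 2 * y) by rewrite mulrAC mulrC.
rewrite -exprVn mul1r -/u; move: s1 s2 s3 s4 s5.
move: (m%:R ^+ 2 * y) (u ^+ 2) (v ^+ 2) => z1 z2 z3; lra.
Qed.

(** [E J^2 + K E Y^2] contracts at a rate [b] strictly between [a] and [min (1, g)], so
    [recursion_powR_bound] applies. *)
Lemma card_moment_bound (a : R) :
  0 <= a -> a < 1 -> a < 2 * ((m%:R + delta) / c) ->
  exists2 B, 0 <= B & forall t, (1 <= t)%N ->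
    E t 0 (fun h => card_dev t h ^+ 2) <= B * t%:R `^ (- a).
Proof.
set g := 2 * _ => a0 a1 ag; pose b := (a + Num.min 1 g) / 2.
have am : a < Num.min 1 g by rewrite lt_min a1.
have m1 : Num.min 1 g <= 1 by rewrite ge_min lexx.
have mg : Num.min 1 g <= g by rewrite ge_min lexx orbT.
have ab : a < b by rewrite /b; lra.
have b1 : b <= 1 by rewrite /b; lra.
have bg : b < g by rewrite /b; lra.
have [K1 K10 step1] := card_moment_step; have [K2 K20 step2] := frac_moment_step.
(* Chosen so that [m^2 = K (g - b)]: the [Y] term fed into the recursion of [J] lowers the rate of
   [K Y^2] from [g] to exactly [b]. *)
pose K := m%:R ^+ 2 / (g - b).
have K0 : 0 <= K by rewrite divr_ge0 ?sqr_ge0// subr_ge0 ltW.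
pose j t := E t 0 (fun h => card_dev t h ^+ 2).
pose y t := E t 0 (fun h => frac_dev t h ^+ 2).
have [|t t1|B B0 hB] := @recursion_powR_bound R (fun t => j t + K * y t) a b
    (K1 + K * K2) a0 ab b1.
- by rewrite addr_ge0// mulr_ge0.
- have t0 : 0 < t%:R :> R by rewrite ltr0n.
  have u0 : 0 < t%:R^-1 :> R by rewrite invr_gt0.
  have j0 : 0 <= j t by exact: sq_ge0.
  have mK : m%:R ^+ 2 = K * (g - b) by rewrite mulfVK// gt_eqF// subr_gt0.
  have := step1 t t1; have := ler_wpM2l K0 (step2 t t1).
  rewrite -/g -/(j t) -/(j t.+1) -/(y t) -/(y t.+1) mK -exprVn.
  have : b * (t%:R^-1 * j t) <= 1 * (t%:R^-1 * j t).
    by rewrite ler_wpM2r// mulr_ge0// ltW.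
  move: (t%:R^-1) => u; rewrite -?[u ^- 2]exprVn; lra.
- exists B => // t t1; apply: le_trans (hB t t1).
  by rewrite -/(j t) lerDl mulr_ge0//; exact: sq_ge0.
Qed.

End history_expectation.

(** * Almost sure convergence *)

Lemma greedy_indep_card m w t : (#|` greedy_indep m w t| <= t)%N.
Proof. by rewrite -edge_greedy_pa_graph edge_greedy_card_le. Qed.

Lemma greedy_indep_card_incr m w s k : (1 <= s)%N ->
  (#|` greedy_indep m w s| <= #|` greedy_indep m w (s + k)|
   <= #|` greedy_indep m w s| + k)%N.
Proof.
move=> s1; elim: k => [|k /andP[IH1 IH2]]; first by rewrite !addn0 leqnn.
rewrite addnS; case: (s + k)%N (leq_trans s1 (leq_addr k s)) IH1 IH2 => // t _ IH1 IH2.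
rewrite [greedy_indep m w t.+2]/= -/(greedy_indep m w t.+1) addnS.
case: has; first by rewrite IH1 leqW.
rewrite cardfsU1 (leq_trans IH1 (leq_addl _ _))/= -[leqRHS]add1n.
by rewrite leq_add// leq_b1.
Qed.

(** Over [t] the difference is [(b - a) - (t - s) (a / s)], where [a] and [b] are the two
    cardinalities; both terms lie between 0 and [t - s]. *)
Lemma greedy_indep_frac_lip (R : realType) m w (wm : R) s t : (1 <= s <= t)%N ->
  `|(#|` greedy_indep m w t|%:R / t%:R - wm)
    - (#|` greedy_indep m w s|%:R / s%:R - wm)| <= (t - s)%:R / t%:R :> R.
Proof.
move=> /andP[s1 st].
have /andP[h1 h2] := greedy_indep_card_incr m w (t - s) s1.
rewrite subnKC// in h1 h2; have h3 := greedy_indep_card m w s.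
set a := #|` greedy_indep m w s| in h1 h2 h3 *.
set b := #|` greedy_indep m w t| in h1 h2 *.
have s0 : 0 < s%:R :> R by rewrite ltr0n.
have t0 : 0 < t%:R :> R by rewrite ltr0n (leq_trans s1).
have tsE : (t - s)%:R = t%:R - s%:R :> R by rewrite natrB.
have H1 : a%:R <= b%:R :> R by rewrite ler_nat.
have H2 : b%:R <= a%:R + (t%:R - s%:R) :> R by rewrite -tsE -natrD ler_nat.
have x0 : 0 <= a%:R / s%:R :> R by rewrite divr_ge0.
have x1 : a%:R / s%:R <= 1 :> R by rewrite ler_pdivrMr// mul1r ler_nat.
have d0 : 0 <= t%:R - s%:R :> R by rewrite -tsE.
have -> : b%:R / t%:R - wm - (a%:R / s%:R - wm)
    = ((b%:R - a%:R) - (t%:R - s%:R) * (a%:R / s%:R)) / t%:R :> R.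
  by field; rewrite !gt_eqF.
rewrite normrM normfV (ger0_norm (ltW t0)) ler_wpM2r ?invr_ge0 ?(ltW t0)// tsE.
have := mulr_ge0 d0 x0; have : (t%:R - s%:R) * (a%:R / s%:R) <= t%:R - s%:R :> R.
  by rewrite ler_piMr.
by rewrite ler_norml; move: (_ * _) => z ? ?; apply/andP; split; lra.
Qed.

Lemma nneseries_le_bound (R : realType) (u : nat -> \bar R) (M : R) :
  (forall n, 0 <= u n)%E -> (forall n, \sum_(k < n) u k <= M%:E)%E ->
  (\sum_(0 <= k <oo) u k <= M%:E)%E.
Proof.
move=> u0 uM; apply: lime_le; first exact: is_cvg_nneseries.
by apply: nearW => n; rewrite big_mkord.
Qed.

Theorem theorem2p9 (R : realType) (d : measure_display)
    (Omega : measurableType d) (P : probability Omega R)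
    (m : nat) (hm : (1 <= m)%N) (delta : R) (hdelta : - m%:R < delta)
    (w : nat -> nat -> {RV P >-> nat})
    (hw : preferential_attachment m delta w)
    (w_m : R) (hw_m01 : 0 < w_m < 1) (hw_m : - w_m + (1 - w_m) ^+ m = 0)
    (chi : R) (hchi0 : 0 < chi)
    (hchi : chi < Num.min (1 / 3)
                    ((2 * m%:R + 2 * delta) / (3 * (2 * m%:R + delta)))) :
  {ae P, forall omega,
    (fun t : nat => t%:R `^ chi *
       `| (#|` greedy_indep m (fun s i => w s i omega) t|)%:R / t%:R - w_m |)
      @ \oo --> (0 : R)}.
Proof.
move: hchi; rewrite lt_min => /andP[chi3 chig].
set g := 2 * ((m%:R + delta) / (2 * m%:R + delta)).
have c0 : 0 < 2 * m%:R + delta by exact: pa_rate_gt0.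
(* The second bound imposed on [chi] is [g / 3]. *)
have chig' : 3 * chi < g.
  have -> : g = 3 * ((2 * m%:R + 2 * delta) / (3 * (2 * m%:R + delta))).
    by rewrite /g; field; rewrite gt_eqF.
  by rewrite ltr_pM2l.
pose a := (3 * chi + Num.min 1 g) / 2.
have cm : 3 * chi < Num.min 1 g by rewrite lt_min chig' andbT; lra.
have a_gt : 3 * chi < a by rewrite /a; lra.
have m1 : Num.min 1 g <= 1 by rewrite ge_min lexx.
have mg : Num.min 1 g <= g by rewrite ge_min lexx orbT.
have a1 : a < 1 by rewrite /a; lra.
have ag : a < g by rewrite /a; lra.
have a0 : 0 <= a by lra.
have [B B0 hB] := card_moment_bound hm hdelta hw hw_m01 hw_m a0 a1 ag.
pose J t omega : R := card_dev w_m t (pa_hist m w t 0 omega).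
have JE t omega : J t omega =
    (#|` greedy_indep m (fun s i => w s i omega) t|)%:R / t%:R - w_m.
  by rewrite /J /card_dev /indep_card pa_hist0 edge_greedy_pa_graph.
(* Shifted by one: index [n] of the series stands for time [n + 1]. *)
pose G n h : R := n.+1%:R `^ (3 * chi - 1) * card_dev w_m n.+1 h ^+ 2.
have G0 n h : 0 <= G n h by rewrite mulr_ge0 ?powR_ge0 ?sqr_ge0.
pose f n omega : \bar R := (G n (pa_hist m w n.+1 0 omega))%:E.
have mf n : measurable_fun setT (f n) by exact: measurable_hist_fun.
have f0 n omega : (0 <= f n omega)%E by rewrite lee_fin.
(* Weight [3 chi - 1] and moment decay [- a] add up to the summable exponent [- (1 + e)]. *)
pose e := a - 3 * chi.
have e0 : 0 < e by rewrite /e subr_gt0.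
have int_f n : (\int[P]_omega f n omega <= (B * n.+1%:R `^ (- (1 + e)))%:E)%E.
  rewrite (integral_hist hm hdelta hw (ltn0Sn n) (G0 n)) lee_fin.
  rewrite [leLHS](_ : _ = n.+1%:R `^ (3 * chi - 1)
      * hist_expect m w n.+1 0 (fun h => card_dev w_m n.+1 h ^+ 2)); last first.
    by rewrite -hist_expectZ.
  have -> : n.+1%:R `^ (- (1 + e)) = n.+1%:R `^ (3 * chi - 1) * n.+1%:R `^ (- a).
    by rewrite -powRD ?pnatr_eq0 ?implybT//; congr (_ `^ _); rewrite /e; lra.
  by rewrite [leRHS]mulrCA ler_wpM2l ?powR_ge0// hB.
(* Sum and integral are exchanged by nonnegativity; the integrals are bounded by a convergent power
   series. *)
have int_sum : (\int[P]_omega \sum_(0 <= n <oo) f n omega < +oo)%E.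
  rewrite integral_nneseries//.
  apply: (@le_lt_trans _ _ (B * (1 + e^-1))%:E); last exact: ltry.
  apply: nneseries_le_bound => [n|n]; first by apply: integral_ge0.
  apply: (@le_trans _ _ (\sum_(k < n) (B * k.+1%:R `^ (- (1 + e)))%:E)%E).
    by apply: lee_sum => k _; exact: int_f.
  by rewrite sumEFin lee_fin -mulr_sumr ler_wpM2l// sum_powRN_le.
have sum0 omega : (0 <= \sum_(0 <= n <oo) f n omega)%E by apply: nneseries_ge0.
have : P.-integrable setT (fun omega => \sum_(0 <= n <oo) f n omega)%E.
  apply/integrableP; split; first exact: ge0_emeasurable_sum.
  by under eq_integral do rewrite gee0_abs//.
(* An integrable sum is finite almost everywhere; its value at [omega] serves as the bound [M] of
   [window_sum_cvg0]. *)
move/integrable_ae => /(_ measurableT); apply: filterS => omega /(_ Logic.I) fin.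
rewrite [X in X @ _ --> _](_ : _ = fun t => t%:R `^ chi * `|J t omega|); last first.
  by apply/funext => t; rewrite JE.
apply: (@window_sum_cvg0 R (J ^~ omega) chi
  (fine (\sum_(0 <= n <oo) f n omega)%E)) => //.
- by lra.
- by move=> s t st; rewrite !JE; exact: greedy_indep_frac_lip.
- move=> n; rewrite -lee_fin fineK// -sumEFin.
  have := nneseries_lim_ge (m := 0) (P := xpredT) n (fun k _ _ => f0 k omega).
  by rewrite big_mkord.
Qed.
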